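(* Let $\pi$ be a Lebesgue probability density on $\mathbb{R}^k$ with $\nabla\log\pi$ Lipschitz continuous, and let $\Lambda\in\mathbb{R}^{k\times k}$ be symmetric positive definite. If $\mathbf{X}(t)$ is the stationary diffusion with generator $G^\Lambda$ and $\mathbf{X}(0)\sim\pi$, then the rate of decay of the autocorrelation of $\log\pi(\mathbf{X}(t))$ at lag $0$ is $\frac{k}{\mathrm{Var}_{X\sim\pi}[\log\pi(X)]}$, uniformly in $\Lambda$ (that is, the value is the same for every choice of $\Lambda$): $$\frac{d}{dt}\mathrm{Corr}\big(\log\pi(\mathbf{X}(0)),\log\pi(\mathbf{X}(t))\big)\Big|_{t=0^+}=-\frac{k}{\mathrm{Var}_{X\sim\pi}[\log\pi(X)]}.$$
   Context: Let $\Sigma=\mathrm{Var}_{X\sim\pi}(\nabla\log\pi(X))$ be the covariance matrix of $\nabla\log\pi(X)$ for $X\sim\pi$, and for $k\times k$ matrices let $A:B=\sum_{i,j}A_{ji}B_{ij}$. A prime denotes transpose and $\nabla^2 f$ is the Hessian of $f$. $G^\Lambda$ is the generator of the anisotropic Langevin diffusion on $\mathbb{R}^k$ with stationary density $\pi$ and anisotropy matrix $\Lambda$, run at standardized speed: $$G^{\Lambda}f=k\Big(\frac{\Lambda}{\Lambda:\Sigma}:\nabla^2f+[\nabla\log\pi]'\frac{\Lambda}{\Lambda:\Sigma}\nabla f\Big).$$ *)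

(* Defs.v *)
From HB Require Import structures.
From mathcomp Require Import all_boot all_order all_algebra.
From mathcomp Require Import all_classical all_reals all_analysis.

Set Implicit Arguments.
Unset Strict Implicit.
Unset Printing Implicit Defensive.
Import Order.TTheory GRing.Theory Num.Theory.
Import numFieldNormedType.Exports.

Local Open Scope classical_set_scope.
Local Open Scope ring_scope.

(* The sigma-algebra on row vectors generated by the coordinate maps, as the   *)
(* library does for tuples; on 'rV[R]_n it is the Borel sigma-algebra of R^n.  *)
Definition measure_rV_display : measure_display -> measure_display.
Proof. exact. Qed.

Section measurable_rV.
Context {d} {T : measurableType d}.
Variable n : nat.

Let coord (i : 'I_n) (x : 'rV[T]_n) : T := x ord0 i.

Let rV_set0 : g_sigma_preimage coord set0.
Proof. exact: sigma_algebra0. Qed.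

Let rV_setC A : g_sigma_preimage coord A -> g_sigma_preimage coord (~` A).
Proof. exact: sigma_algebraC. Qed.

Let rV_bigcup (F : _^nat) : (forall i, g_sigma_preimage coord (F i)) ->
  g_sigma_preimage coord (\bigcup_i (F i)).
Proof. exact: sigma_algebra_bigcup. Qed.

HB.instance Definition _ := @isMeasurable.Build (measure_rV_display d)
  'rV[T]_n (g_sigma_preimage coord) rV_set0 rV_setC rV_bigcup.

End measurable_rV.

Section measurable_rV_theory.
Context d1 d2 (T1 : measurableType d1) (T2 : measurableType d2).

Lemma measurable_rV_coord n (i : 'I_n) :
  measurable_fun [set: 'rV[T2]_n] (fun x : 'rV[T2]_n => x ord0 i).
Proof.
move=> _ Y mY; rewrite setTI; apply: sub_sigma_algebra => /=.
rewrite -bigcup_seq/=; exists i => /=; first by rewrite mem_index_enum.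
by exists Y => //; rewrite setTI.
Qed.

Lemma measurable_fun_rVP n (f : T1 -> 'rV[T2]_n) :
  (forall i, measurable_fun [set: T1] (fun z => f z ord0 i)) ->
  measurable_fun [set: T1] f.
Proof.
move=> mf _ A mA; rewrite setTI.
suff : measurable `<=` image_set_system setT f (@measurable _ T1).
  by move=> /(_ A mA); rewrite /image_set_system /= setTI.
apply: smallest_sub; first exact/sigma_algebra_image/sigma_algebra_measurable.
move=> C; rewrite -bigcup_seq/= => -[i _ [B mB <-]].
by rewrite /image_set_system /= !setTI; have := mf i measurableT B mB; rewrite setTI.
Qed.

End measurable_rV_theory.

Section lebesgue_rV.
Variable R : realType.

Definition rV_cons n (z : measurableTypeR R * 'rV[R]_n) : 'rV[R]_n.+1 :=
  row_mx (const_mx z.1 : 'rV_1) z.2.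

Let rV_uncons n (x : 'rV[R]_n.+1) : measurableTypeR R * 'rV[R]_n :=
  (x ord0 ord0, \row_j x ord0 (lift ord0 j)).

Let rV_consK n : cancel (@rV_cons n) (@rV_uncons n).
Proof.
move=> [a v]; rewrite /rV_uncons /rV_cons/=; congr pair.
  have /esym := row_mxEl (const_mx a : 'rV_1) v ord0 ord0.
  by rewrite mxE => {2}->; congr (row_mx _ _ _ _); apply/val_inj.
apply/rowP => j; rewrite mxE -[RHS](row_mxEr (const_mx a : 'rV_1)).
by congr (row_mx _ _ _ _); apply/val_inj.
Qed.

Lemma measurable_rV_cons n : measurable_fun [set: _] (@rV_cons n).
Proof.
apply: measurable_fun_rVP => i.
case: (split_ordP (i : 'I_(1 + n))) => j ->.
  rewrite (_ : (fun=> _) = fst); first exact: measurable_fst.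
  by apply/funext => z; apply: etrans (row_mxEl _ _ _ _) _; rewrite mxE.
rewrite (_ : (fun=> _) = (fun v : 'rV[R]_n => v ord0 j) \o snd).
  exact: (measurableT_comp (measurable_rV_coord j) measurable_snd).
by apply/funext => z; exact: etrans (row_mxEr _ _ _ _) _.
Qed.

Let measurable_rV_uncons n : measurable_fun [set: _] (@rV_uncons n).
Proof.
apply/measurable_fun_pairP; split => /=.
  exact: measurable_rV_coord.
apply: measurable_fun_rVP => j; under eq_fun do rewrite /= mxE.
exact: measurable_rV_coord.
Qed.

Section cons_measure.
Variables (n : nat) (m : {sigma_finite_measure set 'rV[R]_n -> \bar R}).

Definition cons_measure : set 'rV[R]_n.+1 -> \bar R :=
  pushforward (@lebesgue_measure R \x m)%E (@rV_cons n).

Let measurable_preimage A :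
  measurable A -> measurable (@rV_cons n @^-1` A).
Proof.
by move=> mA; rewrite -[X in measurable X]setTI; exact: measurable_rV_cons.
Qed.

Let cons_measure0 : cons_measure set0 = 0%E.
Proof. by rewrite /cons_measure /pushforward preimage_set0 measure0. Qed.

Let cons_measure_ge0 A : (0 <= cons_measure A)%E.
Proof. by rewrite /cons_measure /pushforward measure_ge0. Qed.

Let cons_measure_sigma_additive : semi_sigma_additive cons_measure.
Proof.
move=> F mF tF mUF; rewrite /cons_measure /pushforward preimage_bigcup.
apply: measure_semi_sigma_additive.
- by move=> i; exact: measurable_preimage.
- apply/trivIsetP => /= i j _ _ ij; rewrite -preimage_setI.
  by move/trivIsetP : tF => /(_ _ _ _ _ ij) ->//; rewrite preimage_set0.
- by rewrite -preimage_bigcup; exact: measurable_preimage.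
Qed.

HB.instance Definition _ := isMeasure.Build _ _ _ cons_measure
  cons_measure0 cons_measure_ge0 cons_measure_sigma_additive.

Let cons_measure_sigma_finite : sigma_finite [set: _] cons_measure.
Proof.
have /sigma_finiteP[F [TF ndF Foo]] := sigma_finiteT (@lebesgue_measure R).
have /sigma_finiteP[G [TG ndG Goo]] := sigma_finiteT m.
exists (fun i => @rV_uncons n @^-1` (F i `*` G i)) => [|i].
  apply/seteqP; split => // x _.
  have [i _ Fi] : (\bigcup_i F i) (rV_uncons x).1 by rewrite -TF.
  have [j _ Gj] : (\bigcup_i G i) (rV_uncons x).2 by rewrite -TG.
  exists (maxn i j) => //; split.
  - by move: Fi; exact/subsetPset/ndF/leq_maxl.
  - by move: Gj; exact/subsetPset/ndG/leq_maxr.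
have [mF Fioo] := Foo i; have [mG Gioo] := Goo i; split.
  rewrite -[X in measurable X]setTI; apply: measurable_rV_uncons => //.
  exact: measurableX.
rewrite /cons_measure /pushforward -comp_preimage.
rewrite (_ : _ \o _ = id) ?preimage_id; last first.
  by apply/funext => z /=; rewrite rV_consK.
by rewrite product_measure1E// lte_mul_pinfty// ge0_fin_numE.
Qed.

HB.instance Definition _ := Measure_isSigmaFinite.Build _ _ _ cons_measure
  cons_measure_sigma_finite.

End cons_measure.

(* Lebesgue measure on R^n, as the n-fold product of Lebesgue measure on R.    *)
Fixpoint lebesgue_measure_rV n :
    {sigma_finite_measure set 'rV[R]_n -> \bar R} :=
  if n is k.+1 then
    cons_measure (lebesgue_measure_rV k)
  else \d_(0 : 'rV[R]_0).

End lebesgue_rV.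

Definition has_density (R : realType) (k : nat)
    (mu : probability 'rV[R]_k R) (p : 'rV[R]_k -> R) : Prop :=
  [/\ measurable_fun [set: 'rV[R]_k] p,
      forall x, 0 <= p x
    & forall A : set 'rV[R]_k, measurable A ->
        mu A = (\int[@lebesgue_measure_rV R k]_(x in A) (p x)%:E)%E].

Section calculus.
Context {R : realType} {k : nat}.
Implicit Types (f : 'rV[R]_k -> R) (x : 'rV[R]_k).

Definition partial (i : 'I_k) f : 'rV[R]_k -> R := 'D_(delta_mx 0 i) f.

Definition grad f x : 'cV[R]_k := \col_i partial i f x.

Definition hessian f x : 'M[R]_k := \matrix_(i, j) partial i (partial j f) x.

Definition C2_compactly_supported f : Prop :=
  [/\ forall x, differentiable f x,
      forall i x, differentiable (partial i f) x,
      forall i j, continuous (partial i (partial j f))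
    & compact (closure [set x | f x != 0])].

(* ln is 0 outside the positive reals, so positivity of p must be required for *)
(* ln o p to be log p. The norms on 'rV and 'cV are sup norms, for which being *)
(* Lipschitz is the same as for the Euclidean ones.                            *)
Definition lipschitz_log_gradient (p : 'rV[R]_k -> R) : Prop :=
  [/\ forall x, 0 < p x,
      forall x, differentiable (@ln R \o p) x
    & exists L : R, L.-lipschitz (grad (@ln R \o p))].

Definition ddot (A B : 'M[R]_k) : R := \sum_i \sum_j A j i * B i j.

Definition sym_posdef (A : 'M[R]_k) : Prop :=
  A^T = A /\ forall v : 'cV[R]_k, v != 0 -> 0 < (v^T *m A *m v) ord0 ord0.

Definition score_covariance (mu : probability 'rV[R]_k R)
    (p : 'rV[R]_k -> R) : 'M[R]_k :=
  \matrix_(i, j) fine (covariance mu (partial i (@ln R \o p))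
                                     (partial j (@ln R \o p))).

Definition langevin_generator (mu : probability 'rV[R]_k R)
    (p : 'rV[R]_k -> R) (Lam : 'M[R]_k) f x : R :=
  let A := (ddot Lam (score_covariance mu p))^-1 *: Lam in
  k%:R * (ddot A (hessian f x)
          + ((grad (@ln R \o p) x)^T *m A *m grad f x) ord0 ord0).

End calculus.

(* Processes are indexed by all of R so as to use the library's reals as time; *)
(* every notion below only looks at times t >= 0.                              *)
Section processes.
Context {d : measure_display} {T : measurableType d} {R : realType}.
Variable P : probability T R.

(* Total-function convention: the value is 0 if a variance is 0 or +oo.        *)
Definition correlation (Y Z : T -> R) : R :=
  fine (covariance P Y Z)
  / (Num.sqrt (fine (variance P Y)) * Num.sqrt (fine (variance P Z))).

Definition is_martingale (F : R -> set (set T)) (M : R -> T -> R) : Prop :=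
  [/\ forall t, 0 <= t -> forall B : set R, measurable B -> F t (M t @^-1` B),
      forall t, 0 <= t -> P.-integrable [set: T] (EFin \o M t)
    & forall s t, 0 <= s -> s <= t -> forall A, F s A ->
        (\int[P]_(w in A) (M t w)%:E = \int[P]_(w in A) (M s w)%:E)%E].

Variable k : nat.
Implicit Type X : R -> {RV P >-> 'rV[R]_k}.

Definition natural_filtration X (t : R) : set (set T) :=
  <<s [set X u @^-1` B | u in `[0, t] & B in measurable] >>.

Definition is_stationary X : Prop :=
  forall (h : R) (n : nat) (t : 'I_n -> R) (B : 'I_n -> set 'rV[R]_k),
    0 <= h -> (forall i, 0 <= t i) -> (forall i, measurable (B i)) ->
    P (\bigcap_i (X (t i + h) @^-1` B i)) = P (\bigcap_i (X (t i) @^-1` B i)).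

(* The diffusion with generator G in the sense of Stroock and Varadhan:        *)
(* continuous paths, and f(X_t) - f(X_0) - int_0^t (G f)(X_u) du is a          *)
(* martingale for every C^2 test function f with compact support.              *)
Definition is_diffusion (G : ('rV[R]_k -> R) -> 'rV[R]_k -> R) X : Prop :=
  (forall w, {within `[0, +oo[, continuous (fun t => X t w)}) /\
  forall f, C2_compactly_supported f ->
    is_martingale (natural_filtration X)
      (fun t w => f (X t w) - f (X 0 w)
         - \int[@lebesgue_measure R]_(u in `[0, t]) G f (X u w)).

End processes.

(* Main.v *)
Require Import Defs.
From HB Require Import structures.
From mathcomp Require Import all_boot all_order all_algebra.
From mathcomp Require Import all_classical all_reals all_analysis.
From mathcomp Require Import measurable_realfun lebesgue_integral_under.
From mathcomp Require Import ring lra.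
Import Order.TTheory GRing.Theory Num.Theory.
Import numFieldNormedType.Exports.
Local Open Scope classical_set_scope.
Local Open Scope ring_scope.

(* Write [psi = ln p] and [D(t) = E (psi(X_t) - psi(X_0))^2]. Stationarity gives
   [corr(0) - corr(t) = D(t) / (2 Var psi)], so the claim is [D(t) / t --> 2 k]. For a test
   function [f] put [D_f(t) = E (f(X_t) - f(X_0))^2] and [g = G f]; the martingale problem
   gives [D_f(t) = - 2 E (f(X_0) \int_0^t g(X_u) du)], hence first [D_f(t) = O(t)] and then
   [|D_f(t) + 2 t <f, g>| <= 3 K t sqrt t] with a constant [K] that only depends on the
   L2(mu) norms of [f] and [g]. This estimate passes to
   the limit along cut-off mollifications [f_n] of [psi]:
   [p] is bounded, so [|grad psi|^2 <= C (1 + |psi|)] is in L2(mu) as soon as [psi] is, the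
   functions [G f_n] stay bounded in L2(mu), and [<f_n, G f_n>] tends to
   [- k A : E (grad psi grad psi') = - k], where [A = Lam / (Lam : Sigma)].
   If [psi] is not in L2(mu) or has variance 0, both sides are 0 by convention. *)

(** * Real-valued integrals *)

(** The obstacle is that [psi] is no test function: it lacks compact support and, with a gradient
    that is merely Lipschitz, need not be twice differentiable. So the generator is only ever
    applied to the [f_n], and three facts keep [G f_n] below a multiple of the weight [1 + |psi|].
    Mollification keeps the second derivatives below the Lipschitz constant [L] at every scale. A
    product of two first derivatives of [psi] costs one power of the weight, not two. And grad psi
    grows at most linearly, which is compensated by the gradient of a cut-off at radius r, of size 1
    / r on |x| <= r. The resulting constant does not depend on n, so n can go to infinity at fixed
    t, and t sqrt t is still o(t) afterwards. The matrix [Lam] drops out because the normalisation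
    makes A : Sigma equal to 1; the division it involves is legitimate because Lam : Sigma = 0 would
    force [psi] to be constant. *)

Section real_integrals.
Local Set Implicit Arguments.
Local Unset Strict Implicit.
Context d (T : measurableType d) (R : realType) (mu : {measure set T -> \bar R}).
Implicit Types (f g h : T -> R).

Definition integ f := mu.-integrable [set: T] (EFin \o f).

Lemma integ_meas f : integ f -> measurable_fun [set: T] f.
Proof. by move=> /(measurable_int mu)/measurable_EFinP. Qed.

Lemma integD f g : integ f -> integ g -> integ (fun x => f x + g x).
Proof. by move=> hf hg; exact: (integrableD measurableT hf hg). Qed.

Lemma integB f g : integ f -> integ g -> integ (fun x => f x - g x).
Proof. by move=> hf hg; exact: (integrableB measurableT hf hg). Qed.

Lemma integZ (c : R) f : integ f -> integ (fun x => c * f x).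
Proof. by move=> hf; exact: (integrableZl measurableT c hf). Qed.

Lemma integ_norm f : integ f -> integ (fun x => `|f x|).
Proof. exact: integrable_norm. Qed.

Lemma integ_le f g : measurable_fun [set: T] f -> (forall x, `|f x| <= g x) ->
  integ g -> integ f.
Proof.
move=> mf fg ig; apply: (le_integrable measurableT _ _ ig); first exact/measurable_EFinP.
move=> x _ /=; rewrite lee_fin; exact: (le_trans (fg x) (ler_norm _)).
Qed.

Lemma integ_sum n (f : 'I_n -> T -> R) : (forall i, integ (f i)) ->
  integ (fun x => \sum_i f i x).
Proof.
elim: n f => [|n IH] f hf.
  by under eq_fun do rewrite big_ord0; exact: integrable0.
under eq_fun do rewrite big_ord_recl.
by apply: integD => //; exact: IH.
Qed.

Lemma Rintegral0 : \int[mu]_x (0 : R) = 0.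
Proof. by rewrite /Rintegral integral0. Qed.

Lemma Rintegral_sum n (a : 'I_n -> R) (f : 'I_n -> T -> R) : (forall i, integ (f i)) ->
  \int[mu]_x (\sum_i a i * f i x) = \sum_i a i * \int[mu]_x f i x.
Proof.
elim: n a f => [|n IH] a f hf.
  rewrite big_ord0 -[RHS]Rintegral0; apply: eq_Rintegral => x _; exact: big_ord0.
rewrite big_ord_recl -IH => [|i]; last exact: hf.
rewrite -RintegralZl; [|exact: measurableT|exact: hf].
rewrite -RintegralD; [|exact: measurableT|exact: integZ|].
  by apply: eq_Rintegral => x _; rewrite big_ord_recl.
by apply: integ_sum => i; exact: integZ.
Qed.

Lemma Rintegral_dominated (f_ : nat -> T -> R) f g :
  (forall n, measurable_fun [set: T] (f_ n)) ->
  (forall x, f_ n x @[n --> \oo] --> f x) ->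
  integ g -> (forall n x, `|f_ n x| <= g x) ->
  integ f /\ \int[mu]_x f_ n x @[n --> \oo] --> \int[mu]_x f x.
Proof.
move=> mf ff ig fg.
have mlim : measurable_fun [set: T] f.
  by apply: (measurable_fun_cvg mf) => x _; exact: ff.
have intf : integ f.
  apply: integ_le ig => // x.
  by apply: (cvgr_to_le (cvg_norm (ff x))); near=> n; exact: fg.
split => //.
have mfE n : measurable_fun setT (EFin \o f_ n) by exact/measurable_EFinP.
have h := @dominated_cvg _ _ _ mu _ measurableT (fun n => EFin \o f_ n) (EFin \o f) (EFin \o g) mfE.
apply: fine_cvg; rewrite fineK; last exact: integrable_fin_num.
apply: h => //.
- by move=> x _; apply: cvg_EFin; [exact: nearW|exact: ff].
- by move=> n x _; rewrite lee_fin.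
Unshelve. all: by end_near.
Qed.

End real_integrals.

(** * Calculus on row vectors *)

Lemma normM_le_sqr {R : realType} (a b : R) : `|a * b| <= (a ^+ 2 + b ^+ 2) / 2.
Proof.
have h1 := sqr_ge0 (a - b); have h2 := sqr_ge0 (a + b).
by rewrite ler_norml; apply/andP; split; nra.
Qed.

(** Stands in for the Cauchy-Schwarz inequality: with [s = sqrt t] it balances a square increment of
    order t against a square of order 1. *)
Lemma normM_le_weighted {R : realType} (a b s : R) : 0 < s ->
  `|a * b| <= 2^-1 * (s^-1 * a ^+ 2 + s * (b * b)).
Proof.
move=> s0; have ns : s != 0 by rewrite gt_eqF.
rewrite -(ler_pM2l s0) -[X in X * `|_|](gtr0_norm s0) -normrM.
have -> : s * (a * b) = a * (s * b) by ring.
apply: (le_trans (normM_le_sqr _ _)); rewrite le_eqVlt; apply/orP; left; apply/eqP.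
by field.
Qed.

Section continuous_real_functions.
Context {R : realType} {T : topologicalType}.
Implicit Types f g : T -> R.

Lemma contM f g : continuous f -> continuous g -> continuous (fun x => f x * g x).
Proof. by move=> cf cg x; apply: (@cvgM _ _ (nbhs x)); [exact: cf|exact: cg]. Qed.

Lemma contD f g : continuous f -> continuous g -> continuous (fun x => f x + g x).
Proof. by move=> cf cg x; apply: (@cvgD _ _ _ (nbhs x)); [exact: cf|exact: cg]. Qed.

Lemma contC (a : R) : continuous (fun _ : T => a).
Proof. by move=> x; exact: cvg_cst. Qed.

Lemma contN f : continuous f -> continuous (fun x => - f x).
Proof. by move=> cf x; apply: (@cvgN _ _ _ (nbhs x)); exact: cf. Qed.

Lemma cont_comp (h : R -> R) f : continuous h -> continuous f -> continuous (fun x => h (f x)).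
Proof. by move=> ch cf x; apply: continuous_comp; [exact: cf|exact: ch]. Qed.

End continuous_real_functions.

Lemma cvg_sumr {R : realType} {S : Type} {F : set_system S} {FF : Filter F}
    {I : Type} (r : seq I) (f : I -> S -> R) (a : I -> R) :
  (forall i, f i x @[x --> F] --> a i) ->
  \sum_(i <- r) f i x @[x --> F] --> \sum_(i <- r) a i.
Proof. by move=> h; apply: cvg_big => //; exact: add_continuous. Qed.

(** A quadratic remainder is o(v), and uniqueness of the differential identifies [D]. Bump functions
    and convolutions are all differentiated this way, from explicit inequalities on the unit
    ball. *)
Lemma diff_of_quadratic {R : realType} {V W : normedModType R} (f : V -> W)
    (x : V) (D : {linear V -> W}) (C : R) : continuous D ->
  (forall v, `|v| <= 1 -> `|f (x + v) - f x - D v| <= C * `|v| ^+ 2) ->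
  differentiable f x /\ 'd f x = D :> (V -> W).
Proof.
move=> Dc h.
have E : f \o shift x = cst (f x) + D +o_ 0 id.
  apply/eqaddoP => _/posnumP[e].
  near=> v.
  rewrite [X in `|X| <= _](_ : _ = f (x + v) - f x - D v); last first.
    by rewrite !fctE /= /shift /= opprD addrA (addrC v).
  have v1 : `|v| <= 1.
    near: v; apply/nbhs_ballP; exists 1 => //= v.
    by rewrite -ball_normE /= sub0r normrN => /ltW.
  apply: (le_trans (h _ v1)).
  have ve : `|v| <= e%:num / (`|C| + 1).
    near: v; apply/nbhs_ballP; exists (e%:num / (`|C| + 1)) => /=.
      by rewrite divr_gt0// ltr_wpDl.
    by move=> v; rewrite -ball_normE /= sub0r normrN => /ltW.
  rewrite expr2 mulrA ler_wpM2r//.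
  apply: (@le_trans _ _ ((`|C| + 1) * `|v|)).
    by rewrite ler_wpM2r//; apply: (le_trans (ler_norm _)); lra.
  by rewrite mulrC -ler_pdivlMr// ltr_wpDl.
have dD : 'd f x = D :> (V -> W) by exact: diff_unique.
split => //; apply/diff_locallyP; split; first by rewrite dD.
by rewrite dD.
Unshelve. all: by end_near.
Qed.

Section row_vector_calculus.
Context {R : realType} {k : nat}.
Implicit Types (f g : 'rV[R]_k -> R) (x y v : 'rV[R]_k).

Lemma rV_coord_le x i : `|x ord0 i| <= `|x|.
Proof.
rewrite {2}/Num.norm /= mx_normrE.
exact: (le_bigmax_cond 0 (fun ij : 'I_1 * 'I_k => `|x ij.1 ij.2|) (j := (ord0, i))).
Qed.

Lemma rV_norm_le x c : 0 <= c -> (forall i, `|x ord0 i| <= c) -> `|x| <= c.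
Proof.
move=> c0 h; rewrite /Num.norm /= mx_normrE; apply/bigmax_leP; split => // -[i j] _ /=.
by rewrite ord1.
Qed.

Lemma rV_delta_norm (i : 'I_k) : `|delta_mx 0 i : 'rV[R]_k| <= 1.
Proof.
apply: rV_norm_le => // j; rewrite mxE; case: eqP => _ /=; last by rewrite normr0.
by case: eqP => _ /=; rewrite ?normr1 ?normr0.
Qed.

Lemma rV_norm_delta (i : 'I_k) (t : R) : `|t *: delta_mx 0 i : 'rV[R]_k| <= `|t|.
Proof. by rewrite normrZ ler_piMr// rV_delta_norm. Qed.

Lemma derive_partialE f x v : differentiable f x ->
  'D_v f x = \sum_i v ord0 i * partial i f x.
Proof.
move=> df; rewrite deriveE// {1}(row_sum_delta v) linear_sum /=.
by apply: eq_bigr => i _; rewrite linearZ /= /partial deriveE.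
Qed.

Lemma is_derive_line f x v (t : R) : differentiable f (x + t *: v) ->
  is_derive t 1 (fun s => f (x + s *: v)) ('D_v f (x + t *: v)).
Proof.
move=> df.
have E : (fun h => h^-1 *: (((fun s => f (x + s *: v)) \o shift t) (h *: 1) - f (x + t *: v)))
   = (fun h => h^-1 *: ((f \o shift (x + t *: v)) (h *: v) - f (x + t *: v))).
  apply/funext => h /=; congr (_ *: (f _ - _)).
  by rewrite /shift /= [h *: 1]mulr1 scalerDl addrCA.
split; first by rewrite /derivable E; exact: diff_derivable.
by rewrite /derive E.
Qed.

Lemma line_mvt f x v : (forall y, differentiable f y) ->
  exists2 c : R, 0 < c < 1 & f (x + v) - f x = 'D_v f (x + c *: v).
Proof.
move=> df.
have dl (t : R) : is_derive t 1 (fun s => f (x + s *: v)) ('D_v f (x + t *: v)).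
  exact: is_derive_line.
have [] := @MVT R (fun s => f (x + s *: v)) (fun s => 'D_v f (x + s *: v)) 0 1 ltr01.
- apply: derivable_within_continuous => t tin; exact: ex_derive.
move=> c; rewrite in_itv/= => c01; rewrite scale1r scale0r addr0 subr0 mulr1 => E.
by exists c.
Qed.

Lemma dot_le v (a : 'I_k -> R) (C : R) : (forall i, `|a i| <= C) ->
  `|\sum_i v ord0 i * a i| <= k%:R * C * `|v|.
Proof.
move=> aC; apply: (le_trans (ler_norm_sum _ _ _)).
apply: (@le_trans _ _ (\sum_(i < k) C * `|v|)).
  by apply: ler_sum => i _; rewrite normrM mulrC ler_pM// rV_coord_le.
by rewrite sumr_const card_ord -[leLHS]mulr_natl mulrA.
Qed.

Lemma taylor1 f (L : R) x v : (forall y, differentiable f y) ->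
  (forall i y z, `|partial i f y - partial i f z| <= L * `|y - z|) ->
  `|f (x + v) - f x - \sum_i v ord0 i * partial i f x| <= k%:R * L * `|v| ^+ 2.
Proof.
move=> df lf; have [c /andP[c0 c1] ->] := line_mvt f x v df.
(* In dimension 0 the Lipschitz hypothesis has no index to be applied to and says nothing on the
   sign of [L], but every vector is 0. *)
have [k0|k0] := posnP k.
  move: f df lf x v; rewrite k0 => f df lf x v.
  have -> : v = 0 by apply/rowP => -[].
  rewrite scaler0 derive0 big_ord0 !subr0 normr0; lra.
have L0 : 0 <= L * `|v|.
  have := le_trans (normr_ge0 _) (lf (Ordinal k0) (x + v) x).
  by rewrite addrAC subrr add0r.
rewrite derive_partialE// -sumrB.
under eq_bigr do rewrite -mulrBr.
rewrite expr2 mulrA -(mulrA k%:R); apply: dot_le => i.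
apply: (le_trans (lf _ _ _)); rewrite addrAC subrr add0r normrZ gtr0_norm// mulrCA.
by rewrite ler_piMl// ltW.
Qed.

Lemma lipschitz1 f (C : R) x v : (forall y, differentiable f y) ->
  (forall i y, `|partial i f y| <= C) ->
  `|f (x + v) - f x| <= k%:R * C * `|v|.
Proof.
move=> df lf; have [c /andP[c0 c1] ->] := line_mvt f x v df.
by rewrite derive_partialE//; exact: dot_le.
Qed.

Definition dotr (a : 'I_k -> R) (v : 'rV[R]_k) : R := \sum_i v ord0 i * a i.

Lemma dotr_is_linear a : linear (dotr a).
Proof.
move=> c u v; rewrite /dotr scaler_sumr -big_split /=; apply: eq_bigr => i _.
by rewrite !mxE mulrDl; congr (_ + _); rewrite -mulrA.
Qed.

HB.instance Definition _ a :=
  GRing.isLinear.Build R 'rV[R]_k R _ (dotr a) (dotr_is_linear a).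

Lemma dotr_continuous a : continuous (dotr a).
Proof.
move=> x; apply: (@cvg_sumr _ _ (nbhs x)) => i; apply: cvgM; last exact: cvg_cst.
exact: coord_continuous.
Qed.

Lemma diff_of_expansion f x (a : 'I_k -> R) (C : R) :
  (forall v, `|v| <= 1 ->
     `|f (x + v) - f x - \sum_i v ord0 i * a i| <= C * `|v| ^+ 2) ->
  differentiable f x /\ forall i, partial i f x = a i.
Proof.
move=> h.
have [df dD] := diff_of_quadratic f x (dotr a) C (dotr_continuous a) h.
split => // i; rewrite /partial deriveE// dD /= /dotr (bigD1 i)//= big1 ?addr0.
  by rewrite mxE !eqxx mul1r.
by move=> j /negPf ji; rewrite mxE ji andbF mul0r.
Qed.

End row_vector_calculus.

Lemma cont_sum {R : realType} {T : topologicalType} {I : Type} (r : seq I) (f : I -> T -> R) :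
  (forall i, continuous (f i)) -> continuous (fun x => \sum_(i <- r) f i x).
Proof. by move=> h x; apply: (@cvg_sumr _ _ (nbhs x)) => i; exact: h. Qed.

Lemma diff_cont {R : realType} {k : nat} (f : 'rV[R]_k -> R) :
  (forall x, differentiable f x) -> continuous f.
Proof. by move=> df x; exact: differentiable_continuous. Qed.

Lemma quotient_bound_continuous {R : realType} {V : normedModType R} (f : V -> R) (K : R) :
  (forall x v, `|f (x + v) - f x| <= K * `|v|) -> continuous f.
Proof.
move=> H x; apply/cvgrPdist_le => /= d d0.
have K0 : 0 < `|K| + 1 by rewrite ltr_wpDl.
near=> y; rewrite distrC -[y in X in `|X|](subrK x) (addrC (y - x)).
apply: (le_trans (H _ _)).
apply: (@le_trans _ _ (`|y - x| * (`|K| + 1))).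
  by rewrite mulrC ler_wpM2l// (le_trans (ler_norm _))// lerDl.
rewrite -ler_pdivlMr// distrC.
near: y; apply: (@cvgr_dist_le _ _ _ (nbhs x)); first exact: cvg_id.
by rewrite divr_gt0.
Unshelve. all: by end_near.
Qed.

(** * Lebesgue measure on row vectors *)

Section row_vector_measure.
Context {R : realType}.
Implicit Types k n : nat.

(** The sigma-algebra is generated by the coordinates, so [U] is written as a countable union of
    products of intervals: [B] lists the open cubes with rational centre and radius 1 / (n + 1), and
    [F] keeps those inside [U]. *)
Lemma open_measurable_rV k (U : set 'rV[R]_k) : open U -> measurable U.
Proof.
move=> oU.
pose B (z : 'rV[rat]_k * nat) : set 'rV[R]_k :=
  [set x | forall i, `|x ord0 i - ratr (z.1 ord0 i)| < z.2.+1%:R^-1].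
have mB z : measurable (B z).
  have -> : B z = \bigcap_(i in [set: 'I_k])
      ((fun x : 'rV[R]_k => x ord0 i) @^-1`
       (`](ratr (z.1 ord0 i) - z.2.+1%:R^-1), (ratr (z.1 ord0 i) + z.2.+1%:R^-1)[%classic)).
    apply/seteqP; split => x /= h i.
      by move=> _ /=; rewrite in_itv/= -ltr_distl; exact: h.
    by have := h i Logic.I; rewrite /= in_itv/= -ltr_distl.
  apply: fin_bigcap_measurable => //= i _.
  rewrite -[X in measurable X]setTI.
  by apply: measurable_rV_coord => //; exact: measurable_itv.
pose F z := if `[< B z `<=` U >] then B z else set0.
have -> : U = \bigcup_z F z.
  apply/seteqP; split => [x Ux|x [z _]]; last first.
    by rewrite /F; case: asboolP => // h; exact: h.
  have /nbhs_ballP[e e0 eU] : nbhs x U by exact: open_nbhs_nbhs.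
  (* A point of the chosen cube and [x] are both within 1 / (n + 1) of its centre, hence the factor
     2. *)
  have [n ne] : exists n : nat, 2 * n.+1%:R^-1 < e.
    have := near_infty_natSinv_lt (PosNum (divr_gt0 e0 (ltr0n _ 2))).
    move=> [N _ /(_ N (leqnn _))] /= h; exists N.
    by move: h; rewrite ltr_pdivlMr// mulrC.
  have qP i : exists q : rat, `|x ord0 i - ratr q| < n.+1%:R^-1.
    have : x ord0 i - n.+1%:R^-1 < x ord0 i + n.+1%:R^-1.
      by rewrite ltrD2l gtrN// invr_gt0.
    move=> /rat_in_itvoo[q]; rewrite in_itv /= => /andP[q1 q2]; exists q.
    by rewrite distrC ltr_distl q1.
  pose q : 'rV[rat]_k := \row_i projT1 (cid (qP i)).
  have qE i : `|x ord0 i - ratr (q ord0 i)| < n.+1%:R^-1.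
    by rewrite mxE; exact: projT2 (cid (qP i)).
  exists (q, n) => //; rewrite /F; case: asboolP => [_|]; first exact: qE.
  case => y yB; apply: eU; rewrite -ball_normE /=.
  apply: (le_lt_trans _ ne); apply: rV_norm_le => [|i].
    by rewrite mulr_ge0// invr_ge0.
  rewrite !mxE.
  apply: (le_trans (ler_distD (ratr (q ord0 i)) _ _)).
  rewrite mulrC mulr_natr mulr2n; apply: lerD; first exact/ltW/qE.
  by rewrite distrC; exact/ltW/yB.
apply: countable_bigcupT_measurable; first exact: countableP.
by move=> z; rewrite /F; case: ifP.
Qed.

Lemma continuous_measurable_rV k (f : 'rV[R]_k -> R) :
  continuous f -> measurable_fun setT f.
Proof.
move=> /continuousP cf; apply: (measurability _ (RGenOpens.measurableE R)).
move=> _ [_ [a [b ->] <-]]; rewrite setTI; apply: open_measurable_rV.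
exact/cf/interval_open.
Qed.

Definition shift_rV k (a : 'rV[R]_k) (x : 'rV[R]_k) : 'rV[R]_k := x + a.

Lemma measurable_shift_rV k (a : 'rV[R]_k) : measurable_fun setT (shift_rV k a).
Proof.
apply: measurable_fun_rVP => i.
rewrite (_ : (fun=> _) = (fun x : 'rV[R]_k => x ord0 i + a ord0 i)).
  apply: measurable_funD; last exact: measurable_cst.
  exact: measurable_rV_coord.
by apply/funext => x; rewrite /shift_rV mxE.
Qed.

Lemma lebesgue_measure_shift (a : R) (A : set R) : measurable A ->
  lebesgue_measure ((fun x : R => x + a) @^-1` A) = lebesgue_measure A.
Proof.
move=> mA.
have mf : measurable_fun [set: measurableTypeR R] (fun x : R => x + a : measurableTypeR R).
  by apply: measurable_funD => //; exact: measurable_cst.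
rewrite -[LHS]/(pushforward (@lebesgue_measure R) (fun x : R => x + a : measurableTypeR R) A).
apply/esym/lebesgue_measure_unique => //= _ [[u v]] _ <-.
rewrite /pushforward (_ : _ @^-1` _ = `]u - a, v - a]%classic).
  rewrite !lebesgue_measure_itv/= !lte_fin ltrD2r.
  by case: ifP => // _; rewrite -!EFinB; congr EFin; ring.
apply/seteqP; split => x /=; rewrite !in_itv/= => /andP[h1 h2];
  by apply/andP; split; lra.
Qed.

(** By induction on the dimension: through [rV_cons] the translation becomes the product map [S],
    and the image of the product measure under [S] agrees with it on rectangles, hence
    everywhere. *)
Lemma lebesgue_rV_shift k (a : 'rV[R]_k) (A : set 'rV[R]_k) : measurable A ->
  lebesgue_measure_rV R k (shift_rV k a @^-1` A) = lebesgue_measure_rV R k A.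
Proof.
elim: k a A => [|k IH] a A mA.
  by congr (lebesgue_measure_rV R 0 _); apply/seteqP; split => x /=; rewrite /shift_rV (_ : x + a = x)//; apply/rowP => -[].
pose a0 := a ord0 ord0; pose a' : 'rV[R]_k := \row_j a ord0 (lift ord0 j).
pose S (z : measurableTypeR R * 'rV[R]_k) : measurableTypeR R * 'rV[R]_k :=
  (z.1 + a0, shift_rV k a' z.2).
have mS : measurable_fun setT S.
  apply/measurable_fun_pairP; split => /=.
    by apply: measurable_funD; [exact: measurable_fst|exact: measurable_cst].
  exact: (measurableT_comp (measurable_shift_rV k a') measurable_snd).
have SE z : shift_rV k.+1 a (rV_cons z) = rV_cons (S z).
  apply/rowP => i; rewrite /shift_rV mxE.
  case: (split_ordP (i : 'I_(1 + k))) => j ->.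
    rewrite (row_mxEl (const_mx z.1 : 'rV_1) z.2) (row_mxEl (const_mx _ : 'rV_1)) !mxE.
    by congr (_ + a _ _); apply/val_inj; rewrite /= ord1.
  rewrite (row_mxEr (const_mx z.1 : 'rV_1) z.2) (row_mxEr (const_mx _ : 'rV_1)) !mxE.
  by congr (_ + a _ _); apply/val_inj.
rewrite /= /cons_measure /pushforward.
have -> : @rV_cons R k @^-1` (shift_rV k.+1 a @^-1` A) = S @^-1` (@rV_cons R k @^-1` A).
  by apply/seteqP; split => z /=; rewrite SE.
have mB : measurable (@rV_cons R k @^-1` A).
  by rewrite -[X in measurable X]setTI; exact: measurable_rV_cons.
rewrite -[LHS]/(pushforward (@lebesgue_measure R \x lebesgue_measure_rV R k)%E S _).
apply/esym/product_measure_unique => //= B C mB' mC.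
rewrite /pushforward.
have -> : S @^-1` (B `*` C) = ((fun x : R => x + a0) @^-1` B) `*` (shift_rV k a' @^-1` C).
  by [].
rewrite product_measure1E; first by congr (_ * _)%E; [exact: lebesgue_measure_shift|exact: IH].
- rewrite -[X in measurable X]setTI.
  by apply: (measurable_funD (f := id)) => //; exact: measurable_cst.
- by rewrite -[X in measurable X]setTI; exact: measurable_shift_rV.
Qed.

(** Given by its lowest corner, which suits both the centred cubes that contain supports and the
    off-centre unit box of [psi_bounded]. *)
Definition box k (a : 'rV[R]_k) (r : R) : set 'rV[R]_k :=
  [set x | forall i, a ord0 i <= x ord0 i <= a ord0 i + r].

Lemma measurable_box k (a : 'rV[R]_k) r : measurable (box k a r).
Proof.
have -> : box k a r = \bigcap_(i in [set: 'I_k])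
      ((fun x : 'rV[R]_k => x ord0 i) @^-1` (`[a ord0 i, a ord0 i + r]%classic)).
  apply/seteqP; split => x /= h i.
    by move=> _ /=; rewrite in_itv/=; exact: h.
  by have := h i Logic.I; rewrite /= in_itv/=.
apply: fin_bigcap_measurable => //= i _.
rewrite -[X in measurable X]setTI.
by apply: measurable_rV_coord => //; exact: measurable_itv.
Qed.

Lemma lebesgue_rV_box k (a : 'rV[R]_k) r : 0 <= r ->
  lebesgue_measure_rV R k (box k a r) = (r ^+ k)%:E.
Proof.
move=> r0; elim: k a => [|k IH] a.
  by rewrite /= diracE expr0 mem_set// => -[].
pose a0 := a ord0 ord0; pose a' : 'rV[R]_k := \row_j a ord0 (lift ord0 j).
rewrite /= /cons_measure /pushforward.
have -> : @rV_cons R k @^-1` box k.+1 a r = `[a0, a0 + r]%classic `*` box k a' r.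
  apply/seteqP; split => -[x v] /=.
    move=> h; split.
      have := h ord0; rewrite in_itv/=.
      rewrite (_ : (rV_cons _) _ _ = x)//.
      have /esym := row_mxEl (const_mx x : 'rV_1) v ord0 ord0.
      by rewrite mxE => {2}->; congr (row_mx _ _ _ _); apply/val_inj.
    move=> i; have := h (lift ord0 i); rewrite [a' _ _]mxE.
    rewrite (_ : (rV_cons _) _ _ = v ord0 i)//.
    rewrite -[RHS](row_mxEr (const_mx x : 'rV_1)).
    by congr (row_mx _ _ _ _); apply/val_inj.
  rewrite in_itv/= => -[h1 h2] i.
  case: (split_ordP (i : 'I_(1 + k))) => j ->.
    rewrite (row_mxEl (const_mx x : 'rV_1) v) !mxE.
    by rewrite (_ : lshift k j = ord0 :> 'I_k.+1)//; apply/val_inj; rewrite /= ord1.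
  rewrite (row_mxEr (const_mx x : 'rV_1) v); have := h2 j; rewrite [a' _ _]mxE.
  by rewrite (_ : lift ord0 j = rshift 1 j :> 'I_k.+1)//; apply/val_inj.
rewrite product_measure1E//; last exact: measurable_box.
rewrite IH /= lebesgue_measure_itv/= lte_fin exprS EFinM; congr (_ * _)%E.
case: ltP => h; last by congr EFin; lra.
by rewrite -EFinB; congr EFin; ring.
Qed.

End row_vector_measure.

(** * Integration against a measure with a density *)

Section density.
Context d (T : measurableType d) (R : realType).
Variables (nu : probability T R) (lam : {sigma_finite_measure set T -> \bar R}).
Variable (q : T -> R).
Hypothesis mq : measurable_fun setT q.
Hypothesis q0 : forall x, 0 <= q x.
Hypothesis nuE : forall A, measurable A -> nu A = (\int[lam]_(x in A) (q x)%:E)%E.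

Lemma density_dominates : nu `<< lam.
Proof.
apply/null_content_dominatesP => A mA lA.
rewrite nuE//; apply: null_set_integral => //.
exact/measurable_funTS/measurable_EFinP.
Qed.

(** The Radon-Nikodym derivative and [q] have the same integral over every measurable set, so they
    agree almost everywhere, and the change of variables known for the former transfers to [q]. *)
Lemma integral_density (f : T -> \bar R) : nu.-integrable setT f ->
  (\int[nu]_x f x = \int[lam]_x (f x * (q x)%:E))%E.
Proof.
move=> intf.
rewrite -(Radon_Nikodym_change_of_variables density_dominates)//=.
have mf := measurable_int _ intf.
have iq : lam.-integrable setT (EFin \o q).
  apply/integrableP; split; first exact/measurable_EFinP.
  under eq_integral do rewrite /= ger0_norm//.
  by rewrite -nuE// probability_setT ltry.
apply: ae_eq_integral => //.
- apply: emeasurable_funM => //; apply: (measurable_int lam).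
  apply: Radon_Nikodym_integrable; exact: density_dominates.
- apply: emeasurable_funM => //; exact/measurable_EFinP.
- apply: ae_eqe_mul2l => /=.
  rewrite Radon_NikodymE//=; first exact: density_dominates.
  move=> dom; case: cid => /= h [h1 h2 h3].
  apply: integral_ae_eq => //=; first exact/measurable_EFinP.
  by move=> E _ mE; rewrite -h3//= nuE.
Qed.

End density.

(** * Product rules and the bump function *)

Section partial_rules.
Context {R : realType} {k : nat}.
Implicit Types (f g : 'rV[R]_k -> R) (x y v : 'rV[R]_k).

Definition scal1 (a t : R) : R := t * a.

Lemma scal1_is_linear a : linear (scal1 a).
Proof. by move=> c u v; rewrite /scal1 mulrDl -mulrA. Qed.

HB.instance Definition _ a :=
  GRing.isLinear.Build R R R _ (scal1 a) (scal1_is_linear a).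

Lemma is_derive_of_quadratic (f : R -> R) s a C :
  (forall t : R, `|t| <= 1 -> `|f (s + t) - f s - t * a| <= C * `|t| ^+ 2) ->
  is_derive s 1 f a.
Proof.
move=> h; have cD : continuous (scal1 a).
  by move=> t; apply: cvgM; [exact: cvg_id|exact: cvg_cst].
have [df dD] := diff_of_quadratic f s (scal1 a) C cD h.
split; first exact: diff_derivable.
by rewrite deriveE// dD /= /scal1 mul1r.
Qed.

Lemma partial_comp (P P' : R -> R) f x : is_derive (f x) 1 P (P' (f x)) ->
  differentiable f x ->
  differentiable (P \o f) x /\
  forall i, partial i (P \o f) x = P' (f x) * partial i f x.
Proof.
move=> dP df; have dP' : differentiable P (f x) by apply/derivable1_diffP; exact: ex_derive.
split => [|i]; first exact: differentiable_comp.
rewrite /partial deriveE; last exact: differentiable_comp.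
rewrite diff_comp//= deriveE// diff1E//= derive1E derive_val.
by rewrite mulrC.
Qed.

Lemma partialM f g x i : differentiable f x -> differentiable g x ->
  partial i (fun y => f y * g y) x = f x * partial i g x + g x * partial i f x.
Proof. by move=> df dg; rewrite /partial deriveM//; exact: diff_derivable. Qed.

Lemma partialD f g x i : differentiable f x -> differentiable g x ->
  partial i (fun y => f y + g y) x = partial i f x + partial i g x.
Proof. by move=> df dg; rewrite /partial deriveD//; exact: diff_derivable. Qed.

Definition C2 f : Prop :=
  [/\ forall x, differentiable f x,
      forall i x, differentiable (partial i f) x
    & forall i j, continuous (partial i (partial j f))].

Lemma partialME f g i : (forall x, differentiable f x) ->
  (forall x, differentiable g x) ->
  partial i (fun y => f y * g y) = fun x => f x * partial i g x + g x * partial i f x.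
Proof. by move=> df dg; apply/funext => x; exact: partialM. Qed.

Lemma partial2M f g i j : C2 f -> C2 g ->
  partial i (partial j (fun y => f y * g y)) = fun x =>
    (f x * partial i (partial j g) x + partial j g x * partial i f x) +
    (g x * partial i (partial j f) x + partial j f x * partial i g x).
Proof.
move=> [df df' _] [dg dg' _]; apply/funext => x.
rewrite partialME// partialD; first by rewrite !partialM.
- exact: differentiableM.
- exact: differentiableM.
Qed.

Lemma C2M f g : C2 f -> C2 g -> C2 (fun y => f y * g y).
Proof.
move=> Cf Cg; have [df df' cf] := Cf; have [dg dg' cg] := Cg; split.
- by move=> x; exact: differentiableM.
- move=> i x; rewrite partialME//.
  by apply: differentiableD; exact: differentiableM.
- move=> i j; rewrite partial2M// => x.
  have cc (h : 'rV[R]_k -> R) : (forall x, differentiable h x) -> continuous h.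
    exact: diff_cont.
  by move: x; apply: contD; apply: contD; apply: contM => //; try exact: cc; exact: cc.
Qed.

(** The strict inequality persists near [x], so the difference quotients are eventually 0. *)
Lemma partial_out f (r : R) i x : (forall y, r < `|y| -> f y = 0) -> r < `|x| ->
  partial i f x = 0.
Proof.
move=> f0 rx; have px : 0 < `|x| - r by rewrite subr_gt0.
rewrite /partial /derive; apply/lim_near_cst => //.
near=> h; rewrite /= /shift /= (f0 x)// f0 ?subrr ?scaler0//.
have hx : `|h| < `|x| - r.
  by near: h; exact: dnbhs0_lt.
have := lerB_normD x (h *: delta_mx 0 i).
have := rV_norm_delta i h.
rewrite (addrC x); move: hx => + + H; move: H; lra.
Unshelve. all: by end_near.
Qed.

End partial_rules.

Section bump.
Context {R : realType} {k : nat}.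
Implicit Types (x y v : 'rV[R]_k) (r : R).

(** The cube is the lowest power of the positive part that is C2, as a test function has to be; the
    powers 2 and 1 appear in its derivatives. *)
Definition pospow (n : nat) (s : R) : R := Num.max 0 s ^+ n.

Lemma pospow_ge0 n s : 0 <= pospow n s.
Proof. by rewrite /pospow exprn_ge0// le_max lexx. Qed.

Lemma is_derive_pospow2 (s : R) : is_derive s (1:R) (pospow 2 : R -> R) (2 * pospow 1 s).
Proof.
apply: (is_derive_of_quadratic _ _ _ 1) => t _; rewrite real_normK ?num_real//.
rewrite /pospow expr1 ler_norml.
by case: (leP 0 s) => hs; case: (leP 0 (s + t)) => hst;
  rewrite ?expr0n/=; apply/andP; split; nra.
Qed.

Lemma is_derive_pospow3 (s : R) : is_derive s (1:R) (pospow 3 : R -> R) (3 * pospow 2 s).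
Proof.
(* On the positive side the remainder is (3 s + t) t^2. If s and s + t have opposite signs then |s|
   <= |t|, and the remainder is at most 4 t^2. *)
apply: (is_derive_of_quadratic _ _ _ (3 * `|s| + 4)) => t ht; rewrite real_normK ?num_real//.
have /andP[t1 t2] : - 1 <= t <= 1 by rewrite -ler_norml.
have s0 := normr_ge0 s; have s1 := ler_norm s.
have tt : 0 <= t ^+ 2 by exact: sqr_ge0.
have sa : 0 <= `|s| * t ^+ 2 by exact: mulr_ge0.
rewrite /pospow ler_norml.
case: (leP 0 s) => hs; case: (leP 0 (s + t)) => hst; rewrite ?expr0n/=.
- rewrite ger0_norm//.
  have -> : (s + t) ^+ 3 - s ^+ 3 - t * (3 * s ^+ 2) = (3 * s + t) * t ^+ 2 by ring.
  have st2 : 0 <= s * t ^+ 2 by rewrite mulr_ge0.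
  rewrite -mulNr; apply/andP; split; rewrite ler_wpM2r//; lra.
- have -> : 0 - s ^+ 3 - t * (3 * s ^+ 2) = (- s - 3 * t) * s ^+ 2 by ring.
  have s2 : s ^+ 2 <= t ^+ 2 by nra.
  have ss : 0 <= s ^+ 2 by exact: sqr_ge0.
  apply/andP; split; first by nra.
  apply: (@le_trans _ _ (4 * s ^+ 2)); last by nra.
  by rewrite ler_wpM2r//; lra.
- rewrite !mulr0 !subr0; have st : s + t <= 1 by lra.
  have h1 : (s + t) ^+ 2 <= t ^+ 2 by nra.
  have h2 : 0 <= (s + t) ^+ 2 by exact: sqr_ge0.
  have -> : (s + t) ^+ 3 = (s + t) * (s + t) ^+ 2 by rewrite exprS.
  by apply/andP; split; nra.
- rewrite !mulr0 !subr0; apply/andP; split; nra.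
Qed.

Lemma pospow1_continuous : continuous (pospow 1).
Proof.
have -> : pospow 1 = (fun s : R => Num.max 0 s).
  by apply/funext => s; rewrite /pospow expr1.
by move=> s; apply: (@continuous_max _ _ (cst 0) id s); [exact: cvg_cst|exact: cvg_id].
Qed.

Lemma pospow2_continuous : continuous (pospow 2).
Proof.
by move=> s; apply: differentiable_continuous; apply/derivable1_diffP; case: (is_derive_pospow2 s).
Qed.

(** Uses the Euclidean norm, which, unlike the sup norm of the row vectors, has a smooth square. It
    is still nonpositive once the sup norm exceeds r > 0. *)
Definition quad r x : R := 1 - \sum_i x ord0 i ^+ 2 / r ^+ 2.

Lemma quad_diff r x : differentiable (quad r) x /\
  forall i, partial i (quad r) x = - 2 * x ord0 i / r ^+ 2.
Proof.
apply: (diff_of_expansion _ _ _ (k%:R / r ^+ 2)) => v _.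
have -> : quad r (x + v) - quad r x - \sum_i v ord0 i * (- 2 * x ord0 i / r ^+ 2)
   = - \sum_i v ord0 i ^+ 2 / r ^+ 2.
  rewrite /quad; have -> : \sum_i (x + v) ord0 i ^+ 2 / r ^+ 2 = \sum_i x ord0 i ^+ 2 / r ^+ 2 -
      \sum_i v ord0 i * (- 2 * x ord0 i / r ^+ 2) + \sum_i v ord0 i ^+ 2 / r ^+ 2.
    rewrite -sumrN -!big_split/=.
    by apply: eq_bigr => i _; rewrite mxE; ring.
  by ring.
rewrite normrN; apply: (le_trans (ler_norm_sum _ _ _)).
apply: (@le_trans _ _ (\sum_(i < k) `|v| ^+ 2 / r ^+ 2)).
  apply: ler_sum => i _; rewrite normrM normfV normrX (ger0_norm (sqr_ge0 r)).
  by rewrite ler_wpM2r ?invr_ge0 ?sqr_ge0// lerXn2r ?nnegrE// rV_coord_le.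
rewrite sumr_const card_ord -[leLHS]mulr_natl le_eqVlt; apply/orP; left.
by apply/eqP; ring.
Qed.

(** Plays two roles: a cut-off when r is large and, once normalised, a mollifier when r is small. *)
Definition bump r x : R := pospow 3 (quad r x).

Lemma bump_diff r x : differentiable (bump r) x /\
  forall i, partial i (bump r) x = 3 * pospow 2 (quad r x) * (- 2 * x ord0 i / r ^+ 2).
Proof.
have [dq pq] := quad_diff r x.
have [db pb] := partial_comp (pospow 3) (fun s => 3 * pospow 2 s) (quad r) x
    (is_derive_pospow3 _) dq.
by split => // i; rewrite -pq -pb.
Qed.

Lemma coord_diff i x : differentiable (fun y : 'rV[R]_k => y ord0 i) x /\
  forall j, partial j (fun y : 'rV[R]_k => y ord0 i) x = (j == i)%:R.
Proof.
apply: (diff_of_expansion _ _ _ 0) => v _; rewrite mul0r (bigD1 i)//= eqxx mulr1 big1; last first.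
  by move=> j /negPf ->; rewrite mulr0.
by rewrite mxE addr0 [X in `|X|](_ : _ = 0) ?normr0//; ring.
Qed.

Lemma bump_partialE r i : partial i (bump r) =
  fun x => (3 * pospow 2 (quad r x)) * (- 2 / r ^+ 2 * x ord0 i).
Proof. by apply/funext => x; rewrite (bump_diff r x).2; ring. Qed.

Lemma bump_partial_diff r i x : differentiable (partial i (bump r)) x /\
  forall j, partial j (partial i (bump r)) x =
    (3 * pospow 2 (quad r x)) * (- 2 / r ^+ 2 * (j == i)%:R) +
    (- 2 / r ^+ 2 * x ord0 i) * (3 * (2 * pospow 1 (quad r x) * (- 2 * x ord0 j / r ^+ 2))).
Proof.
rewrite bump_partialE.
have [dq pq] := quad_diff r x.
have [dp pp] := partial_comp (pospow 2) (fun s => 2 * pospow 1 s) (quad r) x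
    (is_derive_pospow2 _) dq.
have [dc pc] := coord_diff i x.
have dcst a : differentiable (cst a : 'rV[R]_k -> R) x by exact: differentiable_cst.
have pcst a j : partial j (cst a : 'rV[R]_k -> R) x = 0 by rewrite /partial derive_cst.
have d1 : differentiable (fun x => 3 * pospow 2 (quad r x)) x.
  exact: (differentiableM (dcst 3) dp).
have d2 : differentiable (fun x : 'rV[R]_k => - 2 / r ^+ 2 * x ord0 i) x.
  exact: (differentiableM (dcst _) dc).
split; first exact: differentiableM.
move=> j; rewrite partialM//.
have -> : partial j (fun x => 3 * pospow 2 (quad r x)) x = 
     3 * (2 * pospow 1 (quad r x) * (- 2 * x ord0 j / r ^+ 2)).
  by have := partialM (cst 3) _ x j (dcst 3) dp; rewrite /= pcst mulr0 addr0 => ->; rewrite pp pq.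
have -> : partial j (fun x : 'rV[R]_k => - 2 / r ^+ 2 * x ord0 i) x =
     - 2 / r ^+ 2 * (j == i)%:R.
  by have := partialM (cst (- 2 / r ^+ 2)) _ x j (dcst _) dc; rewrite /= pcst mulr0 addr0 => ->; rewrite pc.
by [].
Qed.

Lemma quad_continuous r : continuous (quad r).
Proof. by move=> x; apply: differentiable_continuous; case: (quad_diff r x). Qed.

Lemma bump_C2 r : C2 (bump r).
Proof.
split => [x|i x|i j x]; first by case: (bump_diff r x).
  by case: (bump_partial_diff r i x).
rewrite (_ : partial i _ = fun x => (3 * pospow 2 (quad r x)) * (- 2 / r ^+ 2 * (i == j)%:R) +
    (- 2 / r ^+ 2 * x ord0 j) * (3 * (2 * pospow 1 (quad r x) * (- 2 * x ord0 i / r ^+ 2)))); last first.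
  by apply/funext => y; rewrite (bump_partial_diff r j y).2.
have cc l : continuous (fun y : 'rV[R]_k => y ord0 l) by exact: coord_continuous.
have cp2 := cont_comp _ _ pospow2_continuous (quad_continuous r).
have cp1 := cont_comp _ _ pospow1_continuous (quad_continuous r).
move: x; apply: contD; first by apply: contM; [apply: contM => //; exact: contC|exact: contC].
apply: contM; first by apply: contM => //; exact: contC.
apply: contM; first exact: contC.
apply: contM; first by apply: contM => //; exact: contC.
by apply: contM; [apply: contM => //; exact: contC|exact: contC].
Qed.

Lemma bump_ge0 r x : 0 <= bump r x.
Proof. exact: pospow_ge0. Qed.

Lemma quad_le1 r x : quad r x <= 1.
Proof.
rewrite gerBl; apply: sumr_ge0 => i _.
by rewrite divr_ge0 ?sqr_ge0.
Qed.

Lemma pospow_le1 n r x : pospow n (quad r x) <= 1.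
Proof.
by rewrite /pospow exprn_ile1 ?le_max ?lexx// ge_max ler01 quad_le1.
Qed.

Lemma bump_le1 r x : bump r x <= 1.
Proof. exact: pospow_le1. Qed.

Lemma pospow_out n r x : 0 < r -> r < `|x| -> pospow n.+1 (quad r x) = 0.
Proof.
move=> r0 rx; rewrite /pospow; suff q0 : quad r x <= 0 by rewrite max_l// expr0n.
have [i ri] : exists i, r < `|x ord0 i|.
  apply/existsP; rewrite -[X in is_true X]negbK negb_exists; apply/negP => /forallP h.
  suff : `|x| <= r by rewrite leNgt rx.
  by apply: rV_norm_le => [|i]; [exact: ltW|rewrite leNgt; exact: h].
rewrite subr_le0 (bigD1 i)//=.
have : 1 <= x ord0 i ^+ 2 / r ^+ 2.
  rewrite ler_pdivlMr ?exprn_gt0// mul1r -[leRHS]real_normK ?num_real//.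
  by rewrite lerXn2r ?nnegrE// ltW.
move=> /le_trans; apply; rewrite lerDl sumr_ge0// => j _.
by rewrite divr_ge0 ?sqr_ge0.
Qed.

Lemma bump_out r x : 0 < r -> r < `|x| -> bump r x = 0.
Proof. exact: pospow_out. Qed.

Lemma bump_gt0 r : 0 < bump r 0.
Proof.
rewrite /bump /quad big1 => [|i _]; last by rewrite mxE expr0n/= mul0r.
by rewrite subr0 /pospow max_r// expr1n.
Qed.

(** The second bound is the scaling in r, with 6 = 3 * 2 from the chain rule. The first follows
    because the derivative lives on |x| <= r; it is the one that absorbs the linear growth of grad
    psi. *)
Lemma bump_partial_le r i x : 0 < r -> `|x| * `|partial i (bump r) x| <= 6 /\
  r * `|partial i (bump r) x| <= 6.
Proof.
move=> r0; have [rx|xr] := ltP r `|x|.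
  by rewrite bump_partialE pospow_out// mulr0 mul0r normr0 !mulr0.
suff h : r * `|partial i (bump r) x| <= 6.
  split => //; apply: le_trans h; by rewrite ler_wpM2r.
rewrite bump_partialE.
have xi := le_trans (rV_coord_le x i) xr.
have := pospow_le1 2 r x; have := pospow_ge0 2 (quad r x).
move: (pospow 2 (quad r x)) => p p0 p1.
rewrite !normrM normrN normrV ?unitfE ?gt_eqF ?exprn_gt0//.
rewrite (ger0_norm p0) (ger0_norm (sqr_ge0 r)) !normr_nat.
have -> : r * (3 * p * (2 / r ^+ 2 * `|x ord0 i|)) =
   6 * (p * (`|x ord0 i| / r)) by field; rewrite gt_eqF.
rewrite ler_piMr// mulr_ile1 ?divr_ge0 ?(ltW r0)//.
by rewrite ler_pdivrMr// mul1r.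
Qed.

(** The constant is 6 + 24, one summand for each term of the product rule in [bump_partial_diff]. *)
Lemma bump_partial2_le r i j x : 0 < r ->
  r ^+ 2 * `|partial i (partial j (bump r)) x| <= 30.
Proof.
move=> r0; rewrite (bump_partial_diff r j x).2; have [rx|xr] := ltP r `|x|.
  by rewrite !pospow_out// !(mulr0, mul0r) addr0 normr0 mulr0.
have xi := le_trans (rV_coord_le x i) xr.
have xj := le_trans (rV_coord_le x j) xr.
have := pospow_le1 2 r x; have := pospow_ge0 2 (quad r x).
have := pospow_le1 1 r x; have := pospow_ge0 1 (quad r x).
move: (pospow 2 (quad r x)) (pospow 1 (quad r x)) => p q q0 q1 p0 p1.
rewrite -[X in X * _]ger0_norm ?sqr_ge0// -normrM.
have -> : r ^+ 2 *
   (3 * p * (-2 / r ^+ 2 * (i == j)%:R) +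
    -2 / r ^+ 2 * x ord0 j *
    (3 * (2 * q * (-2 * x ord0 i / r ^+ 2)))) =
  - 6 * (p * (i == j)%:R) +
   24 * (q * ((x ord0 j / r) * (x ord0 i / r))).
  by field; rewrite gt_eqF.
have c l : `|x ord0 l| <= r -> `|x ord0 l / r| <= 1.
  by move=> h; rewrite normrM normfV (gtr0_norm r0) ler_pdivrMr// mul1r.
move: (x ord0 j / r) (x ord0 i / r) (c _ xj) (c _ xi) => a b a1 b1.
apply: (le_trans (ler_normD _ _)); rewrite !normrM normrN (ger0_norm p0) (ger0_norm q0) !normr_nat.
rewrite [leRHS](_ : 30 = 6 + 24); last by rewrite -natrD.
apply: lerD; rewrite ler_piMr// mulr_ile1// ?mulr_ile1 ?mulr_ge0//.
by case: (i == j); rewrite ?normr1 ?normr0.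
Qed.

End bump.

(** * Integration by parts *)

Section compactly_supported.
Context {R : realType} {k : nat}.
Notation lam := (lebesgue_measure_rV R k).
Implicit Types (f g : 'rV[R]_k -> R) (x y v : 'rV[R]_k) (r M : R).

Definition supp_in r f := forall x, r < `|x| -> f x = 0.

Lemma compact_cube r : compact [set x : 'rV[R]_k | `|x| <= r].
Proof.
apply: bounded_closed_compact.
  exists r; split; first exact: num_real.
  by move=> s rs x /= /le_trans; apply; exact: ltW.
apply: (@closed_comp _ _ (fun x : 'rV[R]_k => `|x|) [set t | t <= r]) => [x _|].
  exact: norm_continuous.
exact: closed_le.
Qed.

Lemma supp_bounded r f : continuous f -> supp_in r f ->
  exists2 M, 0 <= M & forall x, `|f x| <= M.
Proof.
move=> cf sf; have [r0|r0] := ltP r 0.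
  exists 0 => // x; rewrite sf ?normr0//; exact: (lt_le_trans r0).
have cn : continuous (fun x => `|f x|) by apply: cont_comp => //; exact: norm_continuous.
have [||z _ zM] := @compact_EVT_max _ R (fun x => `|f x|) _ _ (compact_cube r).
- by exists 0 => /=; rewrite normr0.
- exact: continuous_subspaceT.
exists `|f z| => // x; have [rx|xr] := ltP r `|x|; first by rewrite sf// normr0.
by apply: zM; rewrite inE.
Qed.

Lemma cube_box x r : `|x| <= r -> box k (const_mx (- r)) (2 * r) x.
Proof.
move=> xr i; rewrite mxE; have := le_trans (rV_coord_le x i) xr.
by rewrite ler_norml => /andP[h1 h2]; apply/andP; split; lra.
Qed.

Lemma integrable_box (a : 'rV[R]_k) r M : 0 <= r -> 0 <= M ->
  lam.-integrable setT (EFin \o (fun x => M * \1_(box k a r) x)).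
Proof.
move=> r0 M0; have mB := measurable_box k a r; apply/integrableP; split.
  by apply/measurable_EFinP; apply: measurable_funM; [exact: measurable_cst|exact: measurable_indic].
under eq_integral do rewrite /= ger0_norm ?mulr_ge0// EFinM.
rewrite ge0_integralZl//; last by apply/measurable_EFinP; exact: measurable_indic.
rewrite integral_indic// setIT [X in (_ * X)%E](lebesgue_rV_box k _ r)//.
by rewrite -EFinM ltry.
Qed.

Lemma supp_integrable r M f : measurable_fun setT f -> (forall x, `|f x| <= M) ->
  supp_in r f -> lam.-integrable setT (EFin \o f).
Proof.
move=> mf fM sf.
pose r' := Num.max 0 r; have r'0 : 0 <= r' by rewrite le_max lexx.
have M0 : 0 <= M by exact: le_trans (fM 0).
pose B := box k (const_mx (- r')) (2 * r').
have mB : measurable B by exact: measurable_box.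
apply: (@le_integrable _ _ _ _ _ measurableT _ (EFin \o (fun x => M * \1_B x))).
- exact/measurable_EFinP.
- move=> x _ /=; rewrite lee_fin [leRHS]ger0_norm ?mulr_ge0//.
  have [rx|xr] := ltP r `|x|; first by rewrite sf// normr0 mulr_ge0.
  rewrite indicE mem_set /= ?mulr1n ?mulr1//. apply: (cube_box x r').
  by rewrite le_max xr orbT.
- by apply: integrable_box => //; rewrite mulr_ge0.
Qed.

Lemma cont_supp_integrable r f : continuous f -> supp_in r f ->
  lam.-integrable setT (EFin \o f).
Proof.
move=> cf sf; have [M M0 fM] := supp_bounded r f cf sf.
by apply: (supp_integrable r M) => //; exact: continuous_measurable_rV.
Qed.

Lemma supp_Rint_le r M f : 0 <= r -> continuous f -> (forall x, `|f x| <= M) ->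
  supp_in r f -> `|\int[lam]_x f x| <= M * (2 * r) ^+ k.
Proof.
move=> r0 cf fM sf; have M0 : 0 <= M by exact: le_trans (fM 0).
have intf := cont_supp_integrable r f cf sf.
apply: (le_trans (le_normr_Rintegral _ _)) => //.
pose B := box k (const_mx (- r)) (2 * r).
have mB : measurable B by exact: measurable_box.
have -> : M * (2 * r) ^+ k = \int[lam]_(x in B) M.
  by rewrite Rintegral_cst// [X in fine X](lebesgue_rV_box k)// mulr_ge0.
rewrite [leRHS]Rintegral_mkcond.
apply: le_Rintegral => //.
- by apply: (integrable_norm intf).
- have -> : EFin \o (fun=> M) \_ B = EFin \o (fun x => M * \1_B x).
    by apply/funext => x /=; rewrite patchE indicE; case: ifP; rewrite ?mulr1 ?mulr0.
  by apply: integrable_box => //; rewrite mulr_ge0.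
move=> x _; rewrite patchE; case: ifPn => // xB.
by rewrite sf ?normr0// ltNge; apply: contra xB => xr; rewrite inE; exact: cube_box.
Qed.

Lemma integrable_shift_rV (a : 'rV[R]_k) f : lam.-integrable setT (EFin \o f) ->
  lam.-integrable setT (EFin \o (fun x => f (x + a))).
Proof.
move=> intf; have mf := measurable_int _ intf.
have mS := measurable_shift_rV k a.
apply/integrableP; split; first exact: (measurableT_comp mf mS).
have -> : (\int[lam]_x `|(EFin \o (fun x => f (x + a)%R)) x| =
  \int[pushforward lam (shift_rV k a)]_x `|(EFin \o f) x|)%E.
  rewrite ge0_integral_pushforward//.
  exact: measurableT_comp.
rewrite (eq_measure_integral lam); first by case/integrableP : intf.
by move=> A mA _; exact: lebesgue_rV_shift.
Qed.

Lemma Rintegral_shift_rV (a : 'rV[R]_k) f : lam.-integrable setT (EFin \o f) ->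
  \int[lam]_x f (x + a) = \int[lam]_x f x.
Proof.
move=> intf; have mf := measurable_int _ intf.
have mS := measurable_shift_rV k a.
rewrite /Rintegral; congr fine.
transitivity (\int[pushforward lam (shift_rV k a)]_x (EFin \o f) x)%E.
  by rewrite integral_pushforward//; exact: integrable_shift_rV.
by apply: eq_measure_integral => A mA _; exact: lebesgue_rV_shift.
Qed.

(* Integrals are invariant under translation, so [t |-> \int u (x + t e_i)] is constant. *)
Lemma integral_partial0 (i : 'I_k) r (u : 'rV[R]_k -> R) : (forall x, differentiable u x) ->
  continuous (partial i u) -> supp_in r u -> \int[lam]_x partial i u x = 0.
Proof.
move=> du cu su; have cu0 := diff_cont _ du.
have sdu : supp_in r (partial i u) by move=> x rx; exact: (partial_out u r).
have [M M0 uM] := supp_bounded r _ cu sdu.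
pose f (t : R) (x : 'rV[R]_k) := u (x + t *: delta_mx 0 i).
have intu := cont_supp_integrable r u cu0 su.
have intf t : lam.-integrable setT (EFin \o f t) by exact: integrable_shift_rV.
have df (t : R) x : is_derive t (1 : R) (f^~ x : R -> R) (partial i u (x + t *: delta_mx 0 i)).
  exact: is_derive_line.
(* For t in ]-1, 1[ all translated supports stay in the cube of radius r + 1; the absolute value
   covers negative r + 1. *)
pose B := box k (const_mx (- `|r + 1|)) (2 * `|r + 1|).
have mB : measurable B by exact: measurable_box.
pose G (x : 'rV[R]_k) := M * \1_B x.
have d1E t x : partial1of2 f t x = partial i u (x + t *: delta_mx 0 i).
  by rewrite partial1of2E derive_val.
have := @differentiation_under_integral R _ _ lam f setT measurableT 0 (-1) 1 _ _ _ G.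
have -> : (fun s : R => \int[lam]_y f s y) = cst (\int[lam]_y u y).
  by apply/funext => t; rewrite /f Rintegral_shift_rV.
rewrite derive1_cst => h; transitivity (\int[lam]_y partial1of2 f 0 y).
  by apply: eq_Rintegral => x _; rewrite d1E scale0r addr0.
apply/esym; apply: h.
- by rewrite /= in_itv/=; apply/andP; split; lra.
- by move=> t _; exact: intf.
- by move=> t x _ _; exact: ex_derive.
- by move=> x; rewrite mulr_ge0.
- by apply: integrable_box => //; rewrite mulr_ge0.
- move=> t x; rewrite /= in_itv/= => /andP[t1 t2] _; rewrite d1E /G.
  have [rx|xr] := ltP r `|x + t *: delta_mx 0 i|.
    by rewrite sdu// normr0 mulr_ge0.
  rewrite indicE mem_set /= ?mulr1n ?mulr1//; apply: (cube_box x `|r + 1|).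
  apply: (@le_trans _ _ (r + 1)); last exact: ler_norm.
  have -> : x = (x + t *: delta_mx 0 i) - t *: delta_mx 0 i by rewrite addrK.
  apply: (le_trans (ler_normB _ _)); apply: lerD => //.
  apply: (le_trans (rV_norm_delta i t)); rewrite ler_norml; apply/andP; split; exact: ltW.
Qed.

End compactly_supported.

(** * Mollification *)

Section mollification.
Context {R : realType} {k : nat}.
Notation lam := (lebesgue_measure_rV R k).
Implicit Types (f g h rho : 'rV[R]_k -> R) (x y v : 'rV[R]_k) (r M L e : R).

Lemma box_nbhs (U : set 'rV[R]_k) x : nbhs x U -> exists2 s, 0 < s &
  box k (x - const_mx s) (2 * s) `<=` U.
Proof.
move=> /nbhs_ballP[e /= e0 eU]; exists (e / 2); first by rewrite divr_gt0.
move=> y yB; apply: eU; rewrite -ball_normE /=.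
apply: (@le_lt_trans _ _ (e / 2)); last by rewrite ltr_pdivrMr//; lra.
apply: rV_norm_le => [|i]; first by rewrite divr_ge0// ltW.
have := yB i; rewrite !mxE => /andP[h1 h2].
by rewrite ler_norml; apply/andP; split; lra.
Qed.

(** By continuity [h] exceeds [h x / 2] on a box around [x], whose volume is positive. *)
Lemma Rintegral_gt0_continuous h x : continuous h -> (forall y, 0 <= h y) ->
  lam.-integrable setT (EFin \o h) -> 0 < h x -> 0 < \int[lam]_y h y.
Proof.
move=> ch h0 ih hx.
have [s s0 sU] : exists2 s, 0 < s & box k (x - const_mx s) (2 * s) `<=` [set y | h x / 2 < h y].
  apply: box_nbhs; have := ch x; rewrite /continuous_at => /cvgr_gt; apply.
  by rewrite ltr_pdivrMr//; lra.
set B := box _ _ _ in sU; have mB : measurable B by exact: measurable_box.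
have hx2 : 0 < h x / 2 by rewrite divr_gt0.
have s20 : 0 < 2 * s by rewrite mulr_gt0.
apply: (@lt_le_trans _ _ (\int[lam]_(y in B) (h x / 2))).
  rewrite Rintegral_cst// [X in fine X](lebesgue_rV_box k _ (2 * s)) ?ltW//=.
  by rewrite mulr_gt0// exprn_gt0.
rewrite [leLHS]Rintegral_mkcond; apply: le_Rintegral => //.
- have -> : EFin \o (fun=> h x / 2) \_ B = EFin \o (fun y => h x / 2 * \1_B y).
    by apply/funext => y /=; rewrite patchE indicE; case: ifP; rewrite ?mulr1 ?mulr0.
  by apply: integrable_box; exact: ltW.
- by move=> y _; rewrite patchE; case: ifPn => // /set_mem/sU /ltW.
Qed.

Lemma partial_le_lip f x L i : differentiable f x ->
  (forall v, `|f (x + v) - f x| <= L * `|v|) -> `|partial i f x| <= L.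
Proof.
move=> df fL.
have d : derivable f x (delta_mx 0 i) by exact: diff_derivable.
have L0 : 0 <= L.
  have := fL (delta_mx 0 i); have := rV_delta_norm i.
  have : 0 < `|delta_mx 0 i : 'rV[R]_k|.
    by rewrite normr_gt0; apply/eqP => /rowP/(_ i)/eqP; rewrite !mxE !eqxx oner_eq0.
  move=> n0 _ /(le_trans (normr_ge0 _)); by rewrite pmulr_lge0.
apply: (cvgr_to_le (cvg_norm d)); near=> t.
have t0 : t != 0 by near: t; exact: nbhs_dnbhs_neq.
rewrite normrZ normfV ler_pdivrMl ?normr_gt0// /shift /= (addrC _ x).
apply: (le_trans (fL _)); rewrite mulrC ler_wpM2r//.
exact: rV_norm_delta.
Unshelve. all: by end_near.
Qed.

(** Convolution of [g] with the reflection of [rho]; hence the minus sign in [conv_diff_right]. *)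
Definition conv rho g x := \int[lam]_y (g (x + y) * rho y).

Lemma cont_shift g x : continuous g -> continuous (fun y => g (x + y)).
Proof.
move=> cg y; apply: (@continuous_comp _ _ _ (fun z => x + z) g); last exact: cg.
by apply: (@cvgD _ _ _ (nbhs y)); [exact: cvg_cst|exact: cvg_id].
Qed.

Section weighted_integral.
Variables (rho : 'rV[R]_k -> R) (e : R).
Hypotheses (crho : continuous rho) (srho : supp_in e rho).

Lemma integrable_weighted h : continuous h ->
  lam.-integrable setT (EFin \o (fun y => h y * rho y)).
Proof.
move=> ch; apply: (cont_supp_integrable e); first exact: contM.
by move=> y ey; rewrite srho// mulr0.
Qed.

Lemma weightedB h1 h2 : continuous h1 -> continuous h2 ->
  \int[lam]_y ((h1 y - h2 y) * rho y) =
  \int[lam]_y (h1 y * rho y) - \int[lam]_y (h2 y * rho y).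
Proof.
move=> c1 c2; rewrite -RintegralB//; last 2 first.
- exact: integrable_weighted.
- exact: integrable_weighted.
by apply: eq_Rintegral => y _; rewrite mulrBl.
Qed.

Lemma weighted_sum n (a : 'I_n -> R) (h : 'I_n -> 'rV[R]_k -> R) :
  (forall i, continuous (h i)) ->
  \int[lam]_y ((\sum_i a i * h i y) * rho y) =
  \sum_i a i * \int[lam]_y (h i y * rho y).
Proof.
move=> ch; rewrite -Rintegral_sum; last by move=> i; exact: integrable_weighted.
apply: eq_Rintegral => y _; rewrite mulr_suml; apply: eq_bigr => i _.
by rewrite mulrA.
Qed.

Hypotheses (rho0 : forall y, 0 <= rho y) (rho1 : \int[lam]_y rho y = 1).

Lemma weighted_le h M : continuous h -> (forall y, `|y| <= e -> `|h y| <= M) ->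
  `|\int[lam]_y (h y * rho y)| <= M.
Proof.
move=> ch hM; apply: (le_trans (le_normr_Rintegral _ _)) => //.
  exact: integrable_weighted.
rewrite -[leRHS]mulr1 -rho1 -RintegralZl//; last exact: (cont_supp_integrable e).
apply: le_Rintegral => //.
- exact: (integrable_norm (integrable_weighted _ ch)).
- by apply: integrable_weighted; exact: contC.
- move=> y _; rewrite normrM (ger0_norm (rho0 y)).
  have [ey|ye] := ltP e `|y|; first by rewrite srho// !mulr0.
  by rewrite ler_wpM2r// hM.
Qed.

(** The Taylor remainders of [g] at all points [x + y] have a common quadratic bound, which survives
    averaging against the probability density [rho]. *)
Lemma conv_diff_left g L x : (forall y, differentiable g y) ->
  (forall i, continuous (partial i g)) ->
  (forall i y z, `|partial i g y - partial i g z| <= L * `|y - z|) ->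
  differentiable (conv rho g) x /\
  forall i, partial i (conv rho g) x = conv rho (partial i g) x.
Proof.
move=> dg cdg lg; have cg := diff_cont _ dg.
apply: (diff_of_expansion _ _ _ (k%:R * L)) => v _.
rewrite -(weighted_sum _ _ (fun i y => partial i g (x + y))); last first.
  by move=> i; exact: cont_shift.
rewrite /conv.
have cs : continuous (fun y => \sum_i v ord0 i * partial i g (x + y)).
  by apply: cont_sum => i; apply: contM; [exact: contC|exact: cont_shift].
have c1 : continuous (fun y => g (x + v + y)) by exact: cont_shift.
have c2 : continuous (fun y => g (x + y)) by exact: cont_shift.
have c12 : continuous (fun y => g (x + v + y) - g (x + y)).
  by apply: contD => //; exact: contN.
rewrite -weightedB// -weightedB//; apply: weighted_le.
  by apply: contD => //; exact: contN.
by move=> y _; rewrite (addrAC x v y); exact: taylor1.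
Qed.

Lemma conv_close g x M : continuous g ->
  (forall y, `|y| <= e -> `|g (x + y) - g x| <= M) -> `|conv rho g x - g x| <= M.
Proof.
move=> cg h; rewrite -[X in _ - X]mulr1 -rho1 -RintegralZl//; last exact: (cont_supp_integrable e).
rewrite /conv -weightedB//; [|exact: cont_shift|exact: contC].
apply: weighted_le => //; apply: contD; [exact: cont_shift|exact: contC].
Qed.

Lemma conv_lip g L x v : continuous g ->
  (forall y z, `|g y - g z| <= L * `|y - z|) ->
  `|conv rho g (x + v) - conv rho g x| <= L * `|v|.
Proof.
move=> cg lg; rewrite /conv -weightedB; [|exact: cont_shift|exact: cont_shift].
apply: weighted_le => [|y _].
  by apply: contD; [exact: cont_shift|apply: contN; exact: cont_shift].
by apply: (le_trans (lg _ _)); rewrite (_ : _ - _ = v)// opprD addrACA subrr addr0 addrAC subrr add0r.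
Qed.

End weighted_integral.

(** Intended for [rho] a partial derivative of a mollifier, which changes sign: the estimate uses
    the maximum of |rho| times the volume of a cube instead of a total mass. *)
Lemma conv_continuous rho e g L : 0 <= e -> continuous rho -> supp_in e rho -> continuous g ->
  (forall y z, `|g y - g z| <= L * `|y - z|) -> continuous (conv rho g).
Proof.
move=> e0 crho srho cg lg.
have [M M0 rM] := supp_bounded e rho crho srho.
have H x v : `|conv rho g (x + v) - conv rho g x| <= (L * `|v|) * M * (2 * e) ^+ k.
  rewrite /conv -(weightedB rho e)//; [|exact: cont_shift|exact: cont_shift].
  apply: supp_Rint_le => //.
  - apply: contM => //.
    by apply: contD; [exact: cont_shift|apply: contN; exact: cont_shift].
  - move=> y; rewrite normrM ler_pM//.
    by apply: (le_trans (lg _ _)); rewrite (_ : _ - _ = v)// opprD addrACA subrr addr0 addrAC subrr add0r.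
  - by move=> y ey; rewrite srho// mulr0.
apply: (@quotient_bound_continuous _ _ _ (L * M * (2 * e) ^+ k)) => x v.
by apply: (le_trans (H x v)); rewrite le_eqVlt; apply/orP; left; apply/eqP; ring.
Qed.

(** With [g] only continuous the derivative has to fall on the weight: translation invariance turns
    [g (x + v + y) * rho y] into [g (x + y) * rho (y - v)], and [rho] is expanded in v. *)
Lemma conv_diff_right rho e g L x : 0 <= e -> continuous g ->
  (forall y, differentiable rho y) -> supp_in e rho ->
  (forall i, continuous (partial i rho)) ->
  (forall i y z, `|partial i rho y - partial i rho z| <= L * `|y - z|) ->
  differentiable (conv rho g) x /\
  forall i, partial i (conv rho g) x = - conv (partial i rho) g x.
Proof.
move=> e0 cg dr sr cdr lr; have cr := diff_cont _ dr.
pose G := fun y => g (x + y); have cG : continuous G by exact: cont_shift.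
have sdr i : supp_in e (partial i rho) by move=> y ey; exact: (partial_out rho e).
(* The cube of radius e + 1 contains the supports of [rho] and of its translates by |v| <= 1; [G]
   need only be bounded there. *)
pose e1 := e + 1; have e10 : 0 <= e1 by rewrite addr_ge0.
have [M M0 GM] : exists2 M, 0 <= M & forall y, `|y| <= e1 -> `|G y| <= M.
  have cn : continuous (fun x => `|G x|) by apply: cont_comp => //; exact: norm_continuous.
  have [||z _ zM] := @compact_EVT_max _ R (fun x => `|G x|) _ _ (compact_cube e1).
  - by exists 0 => /=; rewrite normr0.
  - exact: continuous_subspaceT.
  by exists `|G z| => // y ye; apply: zM; rewrite inE.
apply: (diff_of_expansion _ _ _ (M * (k%:R * L) * (2 * e1) ^+ k)) => v v1.
have E1 : conv rho g (x + v) = \int[lam]_y (G y * rho (y - v)).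
  have cF : continuous (fun y => G y * rho (y - v)).
    apply: contM => //; under eq_fun do rewrite addrC.
    exact: cont_shift.
  rewrite -(Rintegral_shift_rV v); last first.
    apply: (cont_supp_integrable e1) => // y ye; rewrite sr ?mulr0//.
    have := lerB_dist y v; move: ye v1; rewrite /e1; lra.
  by apply: eq_Rintegral => y _; rewrite /G addrK addrA addrAC (addrAC x).
have cs1 : continuous (fun y => rho (y - v)).
  under eq_fun do rewrite addrC.
  exact: cont_shift.
have ve y : e1 < `|y| -> e < `|y - v|.
  by move=> ye; have := lerB_dist y v; move: ye v1; rewrite /e1; lra.
have E2 : \sum_i v ord0 i * - conv (partial i rho) g x =
    \int[lam]_y (- (G y * \sum_i v ord0 i * partial i rho y)).
  rewrite /conv -/G.
  have iG i : integ lam (fun y => G y * partial i rho y).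
    exact: (integrable_weighted (partial i rho) e).
  transitivity (\sum_i (- v ord0 i) * \int[lam]_y (G y * partial i rho y)).
    by apply: eq_bigr => i _; rewrite mulrN mulNr.
  rewrite -(Rintegral_sum _ iG); apply: eq_Rintegral => y _.
  rewrite mulr_sumr -sumrN; apply: eq_bigr => i _; ring.
have cSr : continuous (fun y => \sum_i v ord0 i * partial i rho y).
  by apply: cont_sum => i; apply: contM => //; exact: contC.
have i1 : integ lam (fun y => G y * rho (y - v)).
  apply: (cont_supp_integrable e1); first exact: contM.
  by move=> y /ve ey; rewrite sr// mulr0.
have i2 : integ lam (fun y => G y * rho y) by exact: (integrable_weighted rho e).
have i3 : integ lam (fun y => - (G y * \sum_i v ord0 i * partial i rho y)).
  apply: (cont_supp_integrable e); first by apply: contN; exact: contM.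
  by move=> y ey; rewrite big1 ?mulr0 ?oppr0// => i _; rewrite sdr// mulr0.
rewrite E1 E2 /conv -/G -RintegralB// -RintegralB//; last exact: integB.
apply: (@le_trans _ _ ((M * (k%:R * L * `|v| ^+ 2)) * (2 * e1) ^+ k)); last first.
  by rewrite le_eqVlt; apply/orP; left; apply/eqP; ring.
have FE y : G y * rho (y - v) - G y * rho y - - (G y * \sum_i v ord0 i * partial i rho y)
   = G y * (rho (y - v) - rho y - \sum_i (- v) ord0 i * partial i rho y).
  have -> : \sum_i (- v) ord0 i * partial i rho y = - \sum_i v ord0 i * partial i rho y.
    by rewrite -sumrN; apply: eq_bigr => i _; rewrite mxE mulNr.
  ring.
under eq_Rintegral do rewrite FE.
have out y : e1 < `|y| -> rho (y - v) - rho y - \sum_i (- v) ord0 i * partial i rho y = 0.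
  move=> ye; rewrite sr; last exact: ve.
  rewrite sr; last by move: ye; rewrite /e1; lra.
  rewrite big1 ?subrr// => i _; rewrite sdr ?mulr0//; move: ye; rewrite /e1; lra.
apply: supp_Rint_le => //.
- apply: contM => //; apply: contD; last apply: contN.
    by apply: contD => //; exact: contN.
  by apply: cont_sum => i; apply: contM => //; exact: contC.
- move=> y; have [ye|ye] := ltP e1 `|y|.
    rewrite out// mulr0 normr0 mulr_ge0//.
    exact: le_trans (taylor1 _ L y v dr lr).
  rewrite normrM ler_pM//; first exact: GM.
  by rewrite -[X in _ * X ^+ 2]normrN; exact: taylor1.
- by move=> y ye; rewrite out// mulr0.
Qed.

Lemma C2_cst (a : R) : C2 (fun _ : 'rV[R]_k => a).
Proof.
have pc (b : R) i : partial i (fun _ : 'rV[R]_k => b) = fun=> 0.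
  by apply/funext => x; rewrite /partial derive_cst.
split => [x|i x|i j].
- exact: differentiable_cst.
- by rewrite pc; exact: differentiable_cst.
- by rewrite !pc; exact: contC.
Qed.

Lemma C2_supp_lipschitz rho e : C2 rho -> supp_in e rho ->
  exists L, forall i y z, `|partial i rho y - partial i rho z| <= L * `|y - z|.
Proof.
move=> [dr d2r c2r] sr.
have sdr i : supp_in e (partial i rho) by move=> y ey; exact: (partial_out rho e).
have bd (ij : 'I_k * 'I_k) : exists M, 0 <= M /\
    forall x, `|partial ij.1 (partial ij.2 rho) x| <= M.
  have [||M M0 h] := supp_bounded e (partial ij.1 (partial ij.2 rho)).
  - exact: c2r.
  - by move=> y ey; apply: (partial_out (partial ij.2 rho) e) => //; exact: sdr.
  by exists M.
have /choice[M hM] := bd.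
exists (k%:R * \sum_ij M ij) => i y z.
rewrite -[y in X in `|X|](subrK z) (addrC (y - z)).
apply: lipschitz1 => [x|j x]; first exact: d2r.
apply: (le_trans ((hM (j, i)).2 x)); rewrite (bigD1 (j, i))//= lerDl.
by apply: sumr_ge0 => ij _; case: (hM ij).
Qed.

(** The first derivative of the convolution is taken on [psi], the second on the mollifier.
    Closeness to [psi] is stated through the local oscillation [M] because [psi] need not be
    uniformly continuous. *)
Lemma mollify psi L e : (forall x, differentiable psi x) ->
  (forall i y z, `|partial i psi y - partial i psi z| <= L * `|y - z|) ->
  0 <= L -> 0 < e ->
  exists phi, [/\ C2 phi,
    forall x M, (forall y, `|y| <= e -> `|psi (x + y) - psi x| <= M) -> `|phi x - psi x| <= M,
    forall i x, `|partial i phi x - partial i psi x| <= L * e &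
    forall i j x, `|partial i (partial j phi) x| <= L].
Proof.
move=> dpsi lpsi L0 e0.
have cpsi := diff_cont _ dpsi.
have cdpsi i : continuous (partial i psi).
  apply: (@quotient_bound_continuous _ _ _ L) => x v.
  by apply: (le_trans (lpsi _ _ _)); rewrite (addrC x) addrK.
have [dbump _ _] := @bump_C2 R k e.
have cbump := diff_cont _ dbump.
have sbump : supp_in e (@bump R k e) by move=> x; exact: bump_out.
pose c := \int[lam]_y bump e y.
have c0 : 0 < c.
  apply: (Rintegral_gt0_continuous _ 0) => //; first by move=> y; exact: bump_ge0.
    exact: (cont_supp_integrable e).
  exact: bump_gt0.
pose rho y := c^-1 * bump e y.
have C2r : C2 rho by apply: C2M; [exact: C2_cst|exact: bump_C2].
have [dr d2r c2r] := C2r; have cr := diff_cont _ dr.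
have r0 y : 0 <= rho y by rewrite mulr_ge0 ?bump_ge0// invr_ge0 ltW.
have sr : supp_in e rho by move=> y ey; rewrite /rho sbump ?mulr0.
have r1 : \int[lam]_y rho y = 1.
  rewrite RintegralZl//; last exact: (cont_supp_integrable e).
  by rewrite mulVf// gt_eqF.
have [L' hL'] := C2_supp_lipschitz rho e C2r sr.
have cdr i : continuous (partial i rho) by apply: diff_cont; exact: d2r.
have sdr i : supp_in e (partial i rho) by move=> y ey; exact: (partial_out rho e).
have H1 x := conv_diff_left rho e cr sr r0 r1 psi L x dpsi cdpsi lpsi.
have E1 j : partial j (conv rho psi) = conv rho (partial j psi).
  by apply/funext => x; case: (H1 x).
have H2 j x := conv_diff_right rho e (partial j psi) L' x (ltW e0) (cdpsi j) dr sr cdr hL'.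
have E2 i j : partial i (partial j (conv rho psi)) =
   fun x => - conv (partial i rho) (partial j psi) x.
  by apply/funext => x; rewrite E1; case: (H2 j x).
exists (conv rho psi); split.
- split; first by move=> x; case: (H1 x).
    by move=> i x; rewrite E1; case: (H2 i x).
  move=> i j; rewrite E2; apply: contN.
  exact: (conv_continuous _ e _ L (ltW e0)).
- by move=> x M h; apply: (conv_close rho e).
- move=> i x; rewrite E1; apply: (conv_close rho e) => // y ye.
  by apply: (le_trans (lpsi _ _ _)); rewrite (addrC x) addrK ler_wpM2l.
(* Bounding formula [E2] directly would give a constant that blows up as e tends to 0. Averaging
   preserves the Lipschitz constant of [partial j psi], which gives exactly [L]. *)
- move=> i j x; rewrite E1; apply: partial_le_lip; first by case: (H2 j x).
  by move=> v; apply: (conv_lip rho e).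
Qed.

End mollification.

(** * Estimates on the log-density *)

Section log_density.
Context {R : realType} {k : nat}.
Notation lam := (lebesgue_measure_rV R k).
Variables (mu : probability 'rV[R]_k R) (p psi : 'rV[R]_k -> R) (L : R).
Hypothesis hp : has_density mu p.
Hypothesis pE : forall x, p x = expR (psi x).
Hypothesis dpsi : forall x, differentiable psi x.
Hypothesis L0 : 0 < L.
Hypothesis lpsi : forall i y z, `|partial i psi y - partial i psi z| <= L * `|y - z|.
Implicit Types (f u : 'rV[R]_k -> R) (x y v : 'rV[R]_k).

Lemma dpsi_continuous i : continuous (partial i psi).
Proof.
apply: (@quotient_bound_continuous _ _ _ L) => x v.
by apply: (le_trans (lpsi _ _ _)); rewrite (addrC x) addrK.
Qed.

Lemma p_gt0 x : 0 < p x.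
Proof. by rewrite pE expR_gt0. Qed.

Lemma p_diff x : differentiable p x /\ forall i, partial i p x = p x * partial i psi x.
Proof.
have -> : p = expR \o psi by apply/funext => y; rewrite pE.
exact: (partial_comp expR expR psi x (is_derive_expR _)).
Qed.

Lemma p_continuous : continuous p.
Proof. by apply: diff_cont => x; case: (p_diff x). Qed.

(* The unit box with corner [x] in the orthant where the gradient at [x] points upwards
   has mass at least [p x * exp (- k L)]. *)
Lemma psi_bounded x : psi x <= k%:R * L.
Proof.
pose a : 'rV[R]_k := \row_i (if 0 <= partial i psi x then x ord0 i else x ord0 i - 1).
have [mp p0 muE] := hp; have mB := measurable_box k a 1.
have low y : box k a 1 y -> expR (psi x - k%:R * L) <= p y.
  move=> yB; rewrite pE ler_expR.
  have := taylor1 psi L x (y - x) dpsi lpsi; rewrite (addrC x) subrK.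
  have v1 : `|y - x| <= 1.
    apply: rV_norm_le => // i; have := yB i; rewrite !mxE ler_norml => /andP[].
    by case: ifP => _ h1 h2; apply/andP; split; lra.
  have s0 : 0 <= \sum_i (y - x) ord0 i * partial i psi x.
    apply: sumr_ge0 => i _; have := yB i; rewrite !mxE => /andP[].
    case: (leP 0 (partial i psi x)) => h h1 h2; first by rewrite mulr_ge0// subr_ge0.
    by apply: mulr_le0; [lra|exact: ltW].
  have : k%:R * L * `|y - x| ^+ 2 <= k%:R * L.
    by rewrite ler_piMr ?mulr_ge0 ?(ltW L0)// exprn_ile1.
  by rewrite ler_norml => h /andP[h1 h2]; lra.
have : ((expR (psi x - k%:R * L))%:E <= 1%:E)%E.
  apply: (@le_trans _ _ (mu (box k a 1))); last exact: probability_le1.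
  rewrite muE//; apply: (@le_trans _ _ (\int[lam]_(y in box k a 1) (expR (psi x - k%:R * L))%:E)%E).
    by rewrite integral_cst// [X in (_ * X)%E](lebesgue_rV_box k a 1)// expr1n mule1.
  apply: ge0_le_integral => //.
  exact/measurable_funTS/measurable_EFinP.
rewrite lee_fin => h; have : expR (psi x - k%:R * L) <= expR 0 by rewrite expR0.
by rewrite ler_expR subr_le0.
Qed.

(** Let K = k L, which is both the upper bound of [psi] and the Taylor constant. A step of length t
    along e_i raises [psi] by at least t d - K t^2, where d is the partial derivative, and cannot
    lead above K. The choice t = d / (2 K) maximises this gain. *)
Lemma dpsi_sqr x i : partial i psi x ^+ 2 <= 4 * (k%:R * L) * (k%:R * L - psi x).
Proof.
have k0 : 0 < (k%:R : R) by rewrite ltr0n; case: i => [m /=]; case: (k).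
have K0 : 0 < k%:R * L by exact: mulr_gt0.
pose t := partial i psi x / (2 * (k%:R * L)).
have := taylor1 psi L x (t *: delta_mx 0 i) dpsi lpsi.
rewrite (bigD1 i)//= big1 ?addr0; last first.
  by move=> j /negPf ji; rewrite !mxE ji andbF mulr0 mul0r.
rewrite !mxE !eqxx mulr1 => h.
have h2 := psi_bounded (x + t *: delta_mx 0 i).
have n2 : `|t *: delta_mx 0 i : 'rV[R]_k| ^+ 2 <= t ^+ 2.
  by rewrite -[leRHS]real_normK ?num_real// lerXn2r ?nnegrE// rV_norm_delta.
have h3 := le_trans h (ler_wpM2l (ltW K0) n2).
move: h3; rewrite ler_norml => /andP[h4 _].
have -> : partial i psi x ^+ 2 = 4 * (k%:R * L) * (t * partial i psi x - k%:R * L * t ^+ 2).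
  by rewrite /t; field; rewrite gt_eqF//= gt_eqF.
by rewrite ler_pM2l ?mulr_gt0//; lra.
Qed.

(** The common dominating weight: its square is [mu]-integrable as soon as [psi] is in L2(mu). *)
Definition wt x : R := 1 + `|psi x|.

Lemma wt_ge1 x : 1 <= wt x.
Proof. by rewrite /wt lerDl. Qed.

(** Three uses: [G] for first-order terms, [Q] for products of two derivatives, which must not cost
    a second power of the weight, and [B] against the gradient of the cut-off. *)
Lemma gradient_bounds : exists G Q B, [/\ 0 <= G, 0 <= Q, 0 <= B &
  forall i j x, [/\ `|partial i psi x| <= G * wt x,
    `|partial i psi x * partial j psi x| <= Q * wt x &
    `|partial i psi x| <= B * (1 + `|x|)]].
Proof.
pose K := k%:R * L; have K0 : 0 <= K by rewrite mulr_ge0// ltW.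
pose Q := 4 * K * (K + 1).
have Q0 : 0 <= Q by rewrite /Q; apply: mulr_ge0; [apply: mulr_ge0|apply: addr_ge0].
have sq i x : partial i psi x ^+ 2 <= Q * wt x.
  have h : K - psi x <= (K + 1) * wt x.
    have := ler_norm (- psi x); rewrite normrN /wt => h.
    have : 0 <= K * `|psi x| by rewrite mulr_ge0.
    lra.
  apply: (le_trans (dpsi_sqr x i)); rewrite /Q -[leRHS]mulrA.
  by apply: ler_wpM2l => //; rewrite mulr_ge0.
exists (Q + 1), Q, (L + \sum_i `|partial i psi 0|); split => //.
- by rewrite addr_ge0.
- by rewrite addr_ge0 ?(ltW L0)// sumr_ge0.
move=> i j x; have w1 := wt_ge1 x; split.
(* Expanding (|a| - 1)^2 >= 0 turns the bound on a^2 into one on |a|, with [Q + 1] as constant. *)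
- have := sq i x; have := sqr_ge0 (`|partial i psi x| - 1).
  rewrite -[_ ^+ 2 in X in _ -> X]real_normK ?num_real//.
  have := normr_ge0 (partial i psi x); rewrite mulrDl mul1r; nra.
- apply: (le_trans (normM_le_sqr _ _)); have := sq i x; have := sq j x; lra.
- have := lpsi i x 0; rewrite subr0 => h.
  have h2 : `|partial i psi x| <= L * `|x| + `|partial i psi 0|.
    rewrite -[partial i psi x in X in X <= _](subrK (partial i psi 0)).
    by apply: (le_trans (ler_normD _ _)); rewrite lerD2r.
  have h3 : `|partial i psi 0| <= \sum_i `|partial i psi 0|.
    by rewrite (bigD1 i)//= lerDl sumr_ge0.
  have x0 := normr_ge0 x; have L0' := ltW L0.
  have h4 : 0 <= `|x| * \sum_i `|partial i psi 0| by rewrite mulr_ge0// sumr_ge0.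
  apply: (le_trans h2); rewrite mulrDr mulr1 mulrDl (mulrC (\sum_i _)); lra.
Qed.

Lemma integ_lam_density f : continuous f -> (forall x, 0 <= f x) ->
  integ mu f -> integ lam (fun x => f x * p x).
Proof.
move=> cf f0 intf; have [mp p0 muE] := hp.
have E := @integral_density _ _ R mu lam p mp p0 muE _ intf.
apply/integrableP; split.
  apply/measurable_EFinP; apply: measurable_funM => //; exact: continuous_measurable_rV.
under eq_integral do rewrite /= ger0_norm ?mulr_ge0// EFinM.
by rewrite -E; exact: integrable_lty.
Qed.

Lemma Rintegral_density f : integ mu f ->
  \int[mu]_x f x = \int[lam]_x (f x * p x).
Proof.
move=> intf; have [mp p0 muE] := hp.
by rewrite /Rintegral (@integral_density _ _ R mu lam p mp p0 muE _ intf).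
Qed.

Lemma cont_supp_integ_mu r f : continuous f -> supp_in r f -> integ mu f.
Proof.
move=> cf sf; have [M M0 fM] := supp_bounded r f cf sf.
apply: (@integ_le _ _ _ _ _ (fun=> M)); [exact: continuous_measurable_rV|by []|].
exact: finite_measure_integrable_cst.
Qed.

(** The integrand times [p] is the partial derivative of [u * p], which is compactly supported. *)
Lemma stein_identity i r u : (forall x, differentiable u x) ->
  continuous (partial i u) -> supp_in r u ->
  \int[mu]_x (partial i u x + u x * partial i psi x) = 0.
Proof.
move=> du cdu su; have cu := diff_cont _ du.
rewrite Rintegral_density; last first.
  apply: (cont_supp_integ_mu r); first by apply: contD => //; apply: contM => //; exact: dpsi_continuous.
  by move=> x rx; rewrite su// mul0r addr0; exact: (partial_out u r).
have E x : partial i (fun x => u x * p x) x = (partial i u x + u x * partial i psi x) * p x.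
  by have [dp pp] := p_diff x; rewrite partialM// pp; ring.
under eq_Rintegral do rewrite -E.
apply: (integral_partial0 i r).
- by move=> x; apply: differentiableM => //; case: (p_diff x).
- have -> : partial i (fun x => u x * p x) = fun x => (partial i u x + u x * partial i psi x) * p x.
    exact/funext.
  apply: contM; last exact: p_continuous.
  by apply: contD => //; apply: contM => //; exact: dpsi_continuous.
- by move=> x rx; rewrite su// mul0r.
Qed.

(** Stein's identity for [u = f * partial j f]. *)
Lemma dirichlet_form i j r f : C2 f -> supp_in r f ->
  \int[mu]_x (f x * (partial i (partial j f) x + partial i psi x * partial j f x)) =
  - \int[mu]_x (partial i f x * partial j f x).
Proof.
move=> [df d2f c2f] sf.
have cf := diff_cont _ df; have cdf l : continuous (partial l f) by apply: diff_cont; exact: d2f.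
have sdf l : supp_in r (partial l f) by move=> x rx; exact: (partial_out f r).
have E := stein_identity i r (fun x => f x * partial j f x).
apply/eqP; rewrite -addr_eq0 -RintegralD//.
- apply/eqP; rewrite -[RHS]E.
  + apply: eq_Rintegral => x _; rewrite partialM//; ring.
  + by move=> x; exact: differentiableM.
  + have -> : partial i (fun x => f x * partial j f x) =
      fun x => f x * partial i (partial j f) x + partial j f x * partial i f x.
      by apply/funext => x; rewrite partialM.
    by apply: contD; apply: contM => //; exact: c2f.
  + by move=> x rx; rewrite sf// mul0r.
- apply: (cont_supp_integ_mu r); last by move=> x rx; rewrite sf// mul0r.
  apply: contM => //; apply: contD; first exact: c2f.
  by apply: contM => //; exact: dpsi_continuous.
- apply: (cont_supp_integ_mu r); first exact: contM.
  by move=> x rx; rewrite sdf// mul0r.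
Qed.

End log_density.

(** * Smooth approximation of the log-density *)

Section approximation.
Context {R : realType} {k : nat}.
Variables (psi : 'rV[R]_k -> R) (L G Q B : R).
Hypothesis dpsi : forall x, differentiable psi x.
Hypothesis L0 : 0 < L.
Hypothesis lpsi : forall i y z, `|partial i psi y - partial i psi z| <= L * `|y - z|.
Hypotheses (G0 : 0 <= G) (Q0 : 0 <= Q) (B0 : 0 <= B).
Hypothesis bounds : forall i j x, [/\ `|partial i psi x| <= G * wt psi x,
    `|partial i psi x * partial j psi x| <= Q * wt psi x &
    `|partial i psi x| <= B * (1 + `|x|)].
Notation w := (wt psi).
Implicit Types (x y v : 'rV[R]_k) (n : nat).

Lemma bump_cvg1 x : bump n.+1%:R x @[n --> \oo] --> (1 : R).
Proof.
rewrite [X in _ --> X](_ : _ = pospow 3 (1 - \sum_i x ord0 i ^+ 2 * 0)); last first.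
  by rewrite big1 => [|i _]; rewrite ?mulr0// subr0 /pospow max_r// expr1n.
have c3 : continuous (@pospow R 3).
  by move=> s; apply: differentiable_continuous; apply/derivable1_diffP; case: (is_derive_pospow3 s).
have h : (quad n.+1%:R x : R) @[n --> \oo] --> (1 - \sum_i x ord0 i ^+ 2 * 0 : R).
  apply: cvgB; first exact: cvg_cst.
  apply: cvg_sumr => i; apply: cvgM; first exact: cvg_cst.
  rewrite -[X in _ --> X](mulr0 0) (_ : (fun n => _) = (fun n => harmonic n * harmonic n)).
    by apply: cvgM; exact: cvg_harmonic.
  by apply/funext => n; rewrite /harmonic /= -exprVn expr2.
exact: (cvg_comp _ _ h (c3 _)).
Qed.

(** Taylor's formula, with the quadratic term absorbed by e <= 1 and w >= 1. This supplies the local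
    oscillation that [mollify] asks for. *)
Lemma psi_near x v (e : R) : 0 <= e -> e <= 1 -> `|v| <= e ->
  `|psi (x + v) - psi x| <= k%:R * (G + L) * w x * e.
Proof.
move=> e0 e1 ve.
have h1 := taylor1 psi L x v dpsi lpsi.
have h2 := dot_le v (fun i => partial i psi x) (G * w x)
  (fun i => let: And3 h _ _ := bounds i i x in h).
have w1 := wt_ge1 psi x.
rewrite -[X in `|X|](subrK (\sum_i v ord0 i * partial i psi x)).
apply: (le_trans (ler_normD _ _)).
have -> : k%:R * (G + L) * w x * e = k%:R * L * (w x * e) + k%:R * (G * w x) * e by ring.
apply: lerD.
  apply: (le_trans h1); rewrite ler_wpM2l ?mulr_ge0 ?(ltW L0)//.
  apply: (@le_trans _ _ e); last by rewrite ler_peMl.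
  rewrite expr2; apply: (@le_trans _ _ (1 * e)); last by rewrite mul1r.
  by rewrite ler_pM// (le_trans ve).
apply: (le_trans h2); rewrite ler_wpM2l// !mulr_ge0// (le_trans ler01 w1)//.
Qed.

Lemma cvg_harmonic_bound (u : nat -> R) (l c : R) :
  (forall n, `|u n - l| <= c * n.+1%:R^-1) -> u n @[n --> \oo] --> l.
Proof.
move=> h.
have ch : c * n.+1%:R^-1 @[n --> \oo] --> c * 0.
  by apply: cvgM; [exact: cvg_cst|exact: cvg_harmonic].
apply: (@squeeze_cvgr _ _ _ _ (fun n => l - c * n.+1%:R^-1) (fun n => l + c * n.+1%:R^-1)).
- by apply: nearW => n; rewrite -ler_distl; exact: h.
- rewrite -[X in _ --> X](subr0 l) -(mulr0 c); apply: cvgB => //; exact: cvg_cst.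
- rewrite -[X in _ --> X](addr0 l) -(mulr0 c); apply: cvgD => //; exact: cvg_cst.
Qed.

Let cst_approx (K L' G' Q' B' : R) :=
  30 * (K + 1) + 12 * (L' + G') + L' + Q' + L' * G' + 12 * (B' * (K + 1)).

Let cst_approx_ge (K L' G' Q' B' : R) :
  0 <= K -> 0 <= L' -> 0 <= G' -> 0 <= Q' -> 0 <= B' ->
  let C := cst_approx K L' G' Q' B' in
  [/\ 0 <= C, 1 * (K + 1) <= C, 1 * (L' + G') + 6 * (K + 1) <= C,
    1 * L' + (L' + G') * 6 + (K + 1) * 30 + 6 * (L' + G') <= C &
    Q' + L' * G' + 12 * (B' * (K + 1)) <= C].
Proof.
rewrite /cst_approx => hK hL hG hQ hB.
have BK : 0 <= B' * (K + 1) by rewrite mulr_ge0// addr_ge0.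
have LG : 0 <= L' * G' by exact: mulr_ge0.
by split; lra.
Qed.

(** Here [f_ n] is the cut-off at radius n + 1 times the mollification at scale 1 / (n + 1). The
    last bounds are what the generator needs: each term of [G f_n] costs a single power of the
    weight, with a constant free of n. *)
Lemma smooth_approximation : exists (f_ : nat -> 'rV[R]_k -> R) (C : R), [/\ 0 <= C,
  forall n, C2 (f_ n) /\ supp_in n.+1%:R (f_ n),
  forall x, f_ n x @[n --> \oo] --> psi x,
  forall i x, partial i (f_ n) x @[n --> \oo] --> partial i psi x &
  forall n x, `|f_ n x| <= C * w x /\ forall i j, [/\ `|partial i (f_ n) x| <= C * w x,
    `|partial i (partial j (f_ n)) x| <= C * w x &
    `|partial i psi x * partial j (f_ n) x| <= C * w x]].
Proof.
have w1 := wt_ge1 psi; have w0 x : 0 <= w x := le_trans ler01 (w1 x).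
have e0 n : 0 < (n.+1%:R : R)^-1 by rewrite invr_gt0.
have e1 n : (n.+1%:R : R)^-1 <= 1 by rewrite invf_le1// ler1n.
have /choice[phi hphi] := fun n => mollify psi L n.+1%:R^-1 dpsi lpsi (ltW L0) (e0 n).
pose f_ n x := bump n.+1%:R x * phi n x.
pose K : R := k%:R * (G + L); have K0 : 0 <= K by rewrite mulr_ge0// addr_ge0// ltW.
have L0' := ltW L0.
have phiE n x : `|phi n x - psi x| <= K * w x * n.+1%:R^-1.
  have [_ h _ _] := hphi n; apply: h => y ye; apply: psi_near => //; exact: ltW.
have dphiE n i x : `|partial i (phi n) x - partial i psi x| <= L * n.+1%:R^-1.
  by have [_ _ h _] := hphi n.
have phib n x : `|phi n x| <= (K + 1) * w x.
  rewrite -[phi n x](subrK (psi x)); apply: (le_trans (ler_normD _ _)).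
  rewrite mulrDl mul1r; apply: lerD; last by rewrite /wt lerDr.
  by apply: (le_trans (phiE n x)); rewrite ler_piMr// mulr_ge0.
have dphib n i x : `|partial i (phi n) x| <= (L + G) * w x.
  rewrite -[partial i (phi n) x](subrK (partial i psi x)); apply: (le_trans (ler_normD _ _)).
  rewrite mulrDl; apply: lerD; last by case: (bounds i i x).
  apply: (le_trans (dphiE n i x)); apply: (@le_trans _ _ L); first by rewrite ler_piMr.
  by rewrite ler_peMr.
have d2phib n i j x : `|partial i (partial j (phi n)) x| <= L * w x.
  by have [_ _ _ h] := hphi n; apply: (le_trans (h i j x)); rewrite ler_peMr.
have b0 n x : `|bump n.+1%:R x| <= 1 by rewrite ger0_norm ?bump_ge0 ?bump_le1.
have r0 n : 0 < (n.+1%:R : R) by [].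
have r1 n : 1 <= (n.+1%:R : R) by rewrite ler1n.
have db n i x : `|partial i (bump n.+1%:R) x| <= 6 * n.+1%:R^-1.
  by rewrite ler_pdivlMr// mulrC; case: (bump_partial_le n.+1%:R i x (r0 n)).
have db' n i x : `|partial i (bump n.+1%:R) x| <= 6.
  by apply: (le_trans (db n i x)); rewrite ler_piMr.
have d2b n i j x : `|partial i (partial j (bump n.+1%:R)) x| <= 30.
  apply: le_trans (bump_partial2_le n.+1%:R i j x (r0 n)).
  by rewrite ler_peMl// exprn_ege1.
have Cb n : C2 (@bump R k n.+1%:R) by exact: bump_C2.
have Cp n : C2 (phi n) by case: (hphi n).
have dfE n i x : partial i (f_ n) x =
    bump n.+1%:R x * partial i (phi n) x + phi n x * partial i (bump n.+1%:R) x.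
  by have [d1 _ _] := Cb n; have [d2 _ _] := Cp n; rewrite /f_ partialM.
pose C : R := cst_approx K L G Q B.
have [C0 c1 c2 c3 c4] := cst_approx_ge _ _ _ _ _ K0 L0' G0 Q0 B0.
have cvg_phi x : phi n x @[n --> \oo] --> psi x by apply: cvg_harmonic_bound (phiE ^~ x).
have cvg_dphi i x : partial i (phi n) x @[n --> \oo] --> partial i psi x.
  exact: cvg_harmonic_bound (fun n => dphiE n i x).
exists f_, C; split => //.
- move=> n; split; first exact: C2M.
  by move=> x nx; rewrite /f_ bump_out ?mul0r.
- move=> x; rewrite -[X in _ --> X]mul1r; apply: cvgM => //; exact: bump_cvg1.
- move=> i x; rewrite -[X in _ --> X]addr0 -[X in _ --> X + _]mul1r.
  rewrite (_ : (fun n => _) = (fun n => bump n.+1%:R x * partial i (phi n) x +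
    phi n x * partial i (bump n.+1%:R) x)); last by apply/funext => n; exact: dfE.
  apply: cvgD; first by apply: cvgM => //; exact: bump_cvg1.
  apply: (cvg_harmonic_bound _ _ ((K + 1) * w x * 6)) => n.
  rewrite subr0 normrM -mulrA; apply: ler_pM => //.
- move=> n x.
  have x0 := normr_ge0 x; have wx := w1 x; have wx0 := w0 x.
  have concl (c t : R) : t <= c * w x -> c <= C -> t <= C * w x.
    by move=> tc cC; apply: (le_trans tc); rewrite ler_wpM2r.
  have N (a b c e : R) : `|a| <= c -> `|b| <= e -> `|a * b| <= c * e.
    by move=> ac be; rewrite normrM ler_pM.
  have A (a b c e : R) : `|a| <= c -> `|b| <= e -> `|a + b| <= c + e.
    by move=> ac be; apply: (le_trans (ler_normD _ _)); exact: lerD.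
  split.
    apply: (concl (1 * (K + 1))) => //.
    by rewrite -mulrA; exact: N.
  move=> i j; have [h1 h2 h3] := bounds i j x; split.
  + apply: (concl (1 * (L + G) + 6 * (K + 1))) => //.
    rewrite dfE; have -> : (1 * (L + G) + 6 * (K + 1)) * w x =
      1 * ((L + G) * w x) + (K + 1) * w x * 6 by ring.
    by apply: (A); exact: N.
  + apply: (concl (1 * L + (L + G) * 6 + (K + 1) * 30 + 6 * (L + G))) => //.
    rewrite partial2M//; have -> : (1 * L + (L + G) * 6 + (K + 1) * 30 + 6 * (L + G)) * w x =
      (1 * (L * w x) + (L + G) * w x * 6) + ((K + 1) * w x * 30 + 6 * ((L + G) * w x)) by ring.
    by apply: (A); apply: (A); exact: N.
  + apply: (concl (Q + L * G + 12 * (B * (K + 1)))) => //.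
    rewrite dfE.
    (* Bounding both gradients separately would give w^2. Instead grad phi is compared with grad
       psi: the main product is controlled by [Q], the difference by [L], and the cut-off term by
       linear growth, where 1 + |x| against the two bounds 6 gives 12. *)
    have -> : partial i psi x * (bump n.+1%:R x * partial j (phi n) x +
       phi n x * partial j (bump n.+1%:R) x) =
       bump n.+1%:R x * (partial i psi x * partial j psi x + partial i psi x * (partial j (phi n) x - partial j psi x))
        + phi n x * (partial i psi x * partial j (bump n.+1%:R) x) by ring.
    have -> : (Q + L * G + 12 * (B * (K + 1))) * w x =
      1 * (Q * w x + (G * w x) * L) + (K + 1) * w x * (12 * B) by ring.
    apply: (A); apply: (N) => //.
      apply: (A) => //; apply: (N) => //.
      by apply: (le_trans (dphiE n j x)); rewrite ler_piMr.
    rewrite normrM; apply: (@le_trans _ _ (B * (1 + `|x|) * `|partial j (bump n.+1%:R) x|)).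
      by rewrite ler_wpM2r.
    have [b1 b2] := bump_partial_le n.+1%:R j x (r0 n).
    rewrite mulrC (mulrC 12) mulrCA ler_wpM2l// mulrDr mulr1 mulrC.
    by have := db' n j x; rewrite mulrC in b1; move: b1; rewrite (mulrC `|x|); lra.
Qed.

End approximation.

(** * The generator *)

Section generator_core.
Context {R : realType} {k : nat}.
Notation lam := (lebesgue_measure_rV R k).
Variables (mu : probability 'rV[R]_k R) (p psi : 'rV[R]_k -> R) (L : R).
Hypothesis hp : has_density mu p.
Hypothesis pE : forall x, p x = expR (psi x).
Hypothesis psiE : @ln R \o p = psi.
Hypothesis dpsi : forall x, differentiable psi x.
Hypothesis L0 : 0 < L.
Hypothesis lpsi : forall i y z, `|partial i psi y - partial i psi z| <= L * `|y - z|.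
Hypothesis iw2 : integ mu (fun x => wt psi x ^+ 2).
Notation w := (wt psi).
Implicit Types (f u : 'rV[R]_k -> R) (x y v : 'rV[R]_k).

Let cpsi : continuous psi.
Proof. exact: diff_cont. Qed.

Let cdpsi i : continuous (partial i psi).
Proof. exact: (dpsi_continuous psi L lpsi). Qed.

Lemma wt_continuous : continuous w.
Proof.
apply: contD; first exact: contC.
by apply: cont_comp => //; exact: norm_continuous.
Qed.

Lemma integ_wt : integ mu w.
Proof.
apply: (integ_le _ _ iw2); first exact: continuous_measurable_rV wt_continuous.
move=> x; have w1 := wt_ge1 psi x.
by rewrite ger0_norm ?(le_trans ler01 w1)// expr2 ler_peMl// (le_trans ler01 w1).
Qed.

Lemma integ_wt_le f (C : R) : measurable_fun setT f -> (forall x, `|f x| <= C * w x) -> integ mu f.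
Proof. by move=> mf fC; apply: (integ_le mf fC); apply: integZ; exact: integ_wt. Qed.

(** Stein's identity for the cut-offs, whose gradients tend to 0. It makes the covariance of the
    score equal to its second moment [score2]. *)
Lemma score_mean i : \int[mu]_x partial i psi x = 0.
Proof.
have [G [Q [B [G0 Q0 B0 bd]]]] := gradient_bounds mu p psi L hp pE dpsi L0 lpsi.
have w1 := wt_ge1 psi.
pose F n x := partial i (bump n.+1%:R) x + bump n.+1%:R x * partial i psi x.
have C2b n := @bump_C2 R k n.+1%:R.
have Fz n : \int[mu]_x F n x = 0.
  have [db d2b c2b] := C2b n.
  apply: (stein_identity mu p psi L hp pE dpsi lpsi i n.+1%:R) => //.
    by apply: diff_cont; exact: d2b.
  by move=> x; exact: bump_out.
have bnd n x : `|partial i (bump n.+1%:R) x| <= 6 * n.+1%:R^-1.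
  by rewrite ler_pdivlMr// mulrC; case: (@bump_partial_le R k n.+1%:R i x (ltr0Sn _ n)).
have [||||_] := @Rintegral_dominated _ _ _ mu F (partial i psi) (fun x => (6 + G) * w x).
- move=> n; apply: continuous_measurable_rV; have [db d2b c2b] := C2b n.
  apply: contD; first by apply: diff_cont; exact: d2b.
  by apply: contM => //; exact: diff_cont.
- move=> x; rewrite -[X in _ --> X]add0r -[X in _ --> _ + X]mul1r; apply: cvgD.
    by apply: (cvg_harmonic_bound _ _ 6) => n; rewrite subr0; exact: bnd.
  by apply: cvgM; [exact: bump_cvg1|exact: cvg_cst].
- by apply: integZ; exact: integ_wt.
- move=> n x; apply: (le_trans (ler_normD _ _)); rewrite mulrDl; apply: lerD.
    apply: (le_trans (bnd n x)); apply: (@le_trans _ _ 6); last by rewrite ler_peMr.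
    by rewrite ler_piMr// invf_le1// ler1n.
  rewrite normrM ger0_norm ?bump_ge0//; have [h _ _] := bd i i x.
  by apply: le_trans h; rewrite ler_piMl// bump_le1.
under eq_cvg do rewrite Fz.
by move=> /(cvg_unique _ (cvg_cst 0)) <-.
Qed.

Definition score2 i j := \int[mu]_x (partial i psi x * partial j psi x).

Lemma score_covarianceE i j : score_covariance mu p i j = score2 i j.
Proof.
rewrite mxE covariance.unlock psiE.
have E l : fine ('E_mu[partial l psi])%E = 0 by rewrite expectation.unlock; exact: score_mean.
rewrite !E expectation.unlock /score2 /Rintegral; congr fine; apply: eq_integral => x _ /=.
by rewrite /GRing.mul /= !subr0.
Qed.

Lemma integ_score2 i j : integ mu (fun x => partial i psi x * partial j psi x).
Proof.
have [G [Q [B [G0 Q0 B0 bd]]]] := gradient_bounds mu p psi L hp pE dpsi L0 lpsi.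
apply: (integ_wt_le _ Q); last by move=> x; case: (bd i j x).
by apply: continuous_measurable_rV; exact: contM.
Qed.

Definition qform (M : 'M[R]_k) (v : 'I_k -> R) : R := \sum_i \sum_j M j i * (v i * v j).

Lemma qformE (M : 'M[R]_k) (v : 'cV[R]_k) :
  (v^T *m M *m v) ord0 ord0 = qform M (fun i => v i ord0).
Proof.
rewrite /qform mxE; apply: eq_bigr => i _; rewrite mxE mulr_suml.
by apply: eq_bigr => j _; rewrite mxE; ring.
Qed.

Lemma integ_qform (M : 'M[R]_k) : integ mu (fun x => qform M (fun i => partial i psi x)).
Proof.
by apply: integ_sum => i; apply: integ_sum => j; apply: integZ; exact: integ_score2.
Qed.

Lemma ddot_score (M : 'M[R]_k) :
  ddot M (score_covariance mu p) = \int[mu]_x qform M (fun i => partial i psi x).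
Proof.
have iS i : integ mu (fun x => \sum_j M j i * (partial i psi x * partial j psi x)).
  by apply: integ_sum => j; apply: integZ; exact: integ_score2.
rewrite /ddot; transitivity (\int[mu]_x (\sum_i 1 * \sum_j M j i * (partial i psi x * partial j psi x))).
  rewrite (Rintegral_sum _ iS); apply: eq_bigr => i _; rewrite mul1r.
  rewrite Rintegral_sum => [|j]; last exact: integ_score2.
  by apply: eq_bigr => j _; rewrite score_covarianceE.
by apply: eq_Rintegral => x _; apply: eq_bigr => i _; rewrite mul1r.
Qed.

(** Lam : Sigma is the mean of a continuous nonnegative quadratic form in grad psi. Since [p] is
    positive everywhere, a zero mean makes the form, and by definiteness the gradient, vanish at
    every point. *)
Lemma ddot_score_eq0_cst (Lam : 'M[R]_k) : sym_posdef Lam ->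
  ddot Lam (score_covariance mu p) = 0 -> forall x y, psi x = psi y.
Proof.
move=> [_ pd] z.
have q0 x : 0 <= qform Lam (fun i => partial i psi x).
  have := pd (\col_i partial i psi x); rewrite qformE.
  have -> : qform Lam (fun i => (\col_i partial i psi x) i ord0) = qform Lam (fun i => partial i psi x).
    by rewrite /qform; apply: eq_bigr => i _; apply: eq_bigr => j _; rewrite !mxE.
  have [E _|ne /(_ isT)/ltW//] := eqVneq (\col_i partial i psi x) 0.
  rewrite /qform big1// => i _; rewrite big1// => j _.
  by have /colP/(_ i) := E; rewrite !mxE => ->; rewrite mul0r mulr0.
have cq : continuous (fun x => qform Lam (fun i => partial i psi x)).
  apply: cont_sum => i; apply: cont_sum => j; apply: contM; first exact: contC.
  exact: contM.
have dz i x : partial i psi x = 0.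
  have [E|ne] := eqVneq (\col_i partial i psi x) 0.
    by have /colP/(_ i) := E; rewrite !mxE.
  have := pd _ ne; rewrite qformE.
  have -> : qform Lam (fun i => (\col_i partial i psi x) i ord0) = qform Lam (fun i => partial i psi x).
    by rewrite /qform; apply: eq_bigr => i' _; apply: eq_bigr => j _; rewrite !mxE.
  move=> qx.
  have := @Rintegral_gt0_continuous R k (fun y => qform Lam (fun i => partial i psi y) * p y) x.
  rewrite -(Rintegral_density mu p hp); last exact: integ_qform.
  rewrite -ddot_score z ltxx => h; suff : false by [].
  have pp := p_gt0 p psi pE.
  apply: h.
  - by apply: contM => //; exact: (p_continuous p psi pE dpsi).
  - by move=> y; rewrite mulr_ge0// ltW.
  - apply: (integ_lam_density mu p hp) => //; exact: integ_qform.
  - exact: mulr_gt0.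
move=> x y; apply/eqP; rewrite -subr_eq0 -normr_le0.
have := lipschitz1 psi 0 y (x - y) dpsi; rewrite (addrC y) subrK mulr0 mul0r; apply.
by move=> i z'; rewrite dz normr0.
Qed.

Section generator.
Variable (Lam : 'M[R]_k).
Hypothesis hLam : sym_posdef Lam.
Notation A := ((ddot Lam (score_covariance mu p))^-1 *: Lam).
Notation G := (langevin_generator mu p Lam).

Lemma generatorE f x : G f x = k%:R * \sum_i \sum_j A j i *
  (partial i (partial j f) x + partial i psi x * partial j f x).
Proof.
rewrite /langevin_generator psiE; congr (_ * _).
rewrite /ddot.
have -> : ((grad psi x)^T *m A *m grad f x) ord0 ord0 =
   \sum_i \sum_j A j i * (partial i psi x * partial j f x).
  rewrite mxE exchange_big /=; apply: eq_bigr => j _; rewrite mxE mulr_suml.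
  apply: eq_bigr => i _; rewrite !mxE.
  have -> : Lam i j = Lam j i by have [/matrixP/(_ j i) + _] := hLam; rewrite mxE.
  ring.
rewrite -big_split /=; apply: eq_bigr => i _; rewrite -big_split /=; apply: eq_bigr => j _.
by rewrite [hessian _ _ _ _]mxE mulrDr.
Qed.

Lemma generator_continuous f : C2 f -> continuous (G f).
Proof.
move=> [df d2f c2f]; rewrite (funext (generatorE f)).
apply: contM; first exact: contC.
apply: cont_sum => i; apply: cont_sum => j; apply: contM; first exact: contC.
by apply: contD => //; apply: contM => //; apply: diff_cont; exact: d2f.
Qed.

Lemma generator_supp r f : supp_in r f -> supp_in r (G f).
Proof.
move=> sf x rx; rewrite generatorE big1 ?mulr0// => i _; rewrite big1// => j _.
have s j' : supp_in r (partial j' f) by move=> y ry; exact: (partial_out f r).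
by rewrite s// (partial_out (partial j f) r)//; [rewrite mulr0 addr0 mulr0|exact: s].
Qed.

Lemma generator_form r f : C2 f -> supp_in r f ->
  \int[mu]_x (f x * G f x) = - (k%:R * \sum_i \sum_j A j i * \int[mu]_x (partial i f x * partial j f x)).
Proof.
move=> C2f sf; have [df d2f c2f] := C2f; have cf := diff_cont _ df.
pose T i j x := f x * (partial i (partial j f) x + partial i psi x * partial j f x).
have iT i j : integ mu (T i j).
  apply: (cont_supp_integ_mu mu r); last by move=> x rx; rewrite /T sf// mul0r.
  apply: contM => //; apply: contD => //; apply: contM => //.
  by apply: diff_cont; exact: d2f.
have iS i : integ mu (fun x => \sum_j A j i * T i j x).
  by apply: integ_sum => j; apply: integZ.
transitivity (k%:R * \int[mu]_x (\sum_i 1 * \sum_j A j i * T i j x)).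
  rewrite -RintegralZl//; last by apply: integ_sum => i; exact: integZ.
  apply: eq_Rintegral => x _; rewrite generatorE mulrCA mulr_sumr; congr (_ * _).
  apply: eq_bigr => i _; rewrite mul1r mulr_sumr; apply: eq_bigr => j _; rewrite /T; ring.
rewrite (Rintegral_sum _ iS) -mulrN -sumrN; congr (_ * _); apply: eq_bigr => i _.
rewrite mul1r (Rintegral_sum _ (iT i)) -sumrN; apply: eq_bigr => j _.
by rewrite (dirichlet_form mu p psi L hp pE dpsi lpsi i j r)// mulrN.
Qed.

Lemma C2_supp_compact r f : C2 f -> supp_in r f -> C2_compactly_supported f.
Proof.
move=> [df d2f c2f] sf; split => //.
apply: (@subclosed_compact _ _ [set x : 'rV[R]_k | `|x| <= r]).
- exact: closed_closure.
- exact: compact_cube.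
- rewrite closureE => x; apply; split.
    apply: (@closed_comp _ _ (fun x : 'rV[R]_k => `|x|) [set t | t <= r]) => [y _|].
      exact: norm_continuous.
    exact: closed_le.
  by move=> y /= fy; rewrite leNgt; apply: contra fy => ry; rewrite sf.
Qed.

(** The bound [M] depends on n and only serves integrability along the process; the quantitative
    estimates use [C], which is uniform in n. *)
Lemma core_sequence : ddot Lam (score_covariance mu p) != 0 ->
  exists (f_ : nat -> 'rV[R]_k -> R) (C : R), [/\ 0 <= C,
    forall n, [/\ C2_compactly_supported (f_ n), continuous (f_ n),
      continuous (G (f_ n)) & exists M, forall x, `|f_ n x| <= M /\ `|G (f_ n) x| <= M],
    forall x, f_ n x @[n --> \oo] --> psi x,
    forall n x, `|f_ n x| <= C * w x /\ `|G (f_ n) x| <= C * w x &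
    \int[mu]_x (f_ n x * G (f_ n) x) @[n --> \oo] --> (- k%:R : R)].
Proof.
move=> LS0.
have [Gc [Q [B [G0 Q0 B0 bd]]]] := gradient_bounds mu p psi L hp pE dpsi L0 lpsi.
have [f_ [C [C0 Cf cf cdf bf]]] := smooth_approximation psi L Gc Q B dpsi L0 lpsi G0 Q0 B0 bd.
have cfn n : continuous (f_ n) by have [[df _ _] _] := Cf n; exact: diff_cont.
have cGn n : continuous (G (f_ n)) by apply: generator_continuous; case: (Cf n).
have w0 x : 0 <= w x := le_trans ler01 (wt_ge1 psi x).
pose D := k%:R * \sum_i \sum_j `|A j i| * (C + C).
have Gb n x : `|G (f_ n) x| <= D * w x.
  rewrite generatorE /D -mulrA normrM normr_nat ler_wpM2l// mulr_suml.
  apply: (le_trans (ler_norm_sum _ _ _)); apply: ler_sum => i _.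
  rewrite mulr_suml; apply: (le_trans (ler_norm_sum _ _ _)); apply: ler_sum => j _.
  rewrite normrM -mulrA ler_wpM2l// mulrDl; apply: (le_trans (ler_normD _ _)).
  by have [_ /(_ i j)[_ h3 h4]] := bf n x; apply: lerD.
have D0 : 0 <= D.
  rewrite mulr_ge0// sumr_ge0// => i _; rewrite sumr_ge0// => j _.
  by rewrite mulr_ge0// addr_ge0.
have cdf_cvg i j : \int[mu]_x (partial i (f_ n) x * partial j (f_ n) x) @[n --> \oo] -->
    score2 i j.
  have cd n l : continuous (partial l (f_ n)) by have [[_ d2f _] _] := Cf n; exact: diff_cont.
  have [||||_] := @Rintegral_dominated _ _ _ mu (fun n x => partial i (f_ n) x * partial j (f_ n) x)
      (fun x => partial i psi x * partial j psi x) (fun x => (C * C) * w x ^+ 2).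
  - by move=> n; apply: continuous_measurable_rV; exact: contM.
  - by move=> x; apply: cvgM; exact: cdf.
  - exact: integZ.
  - move=> n x; rewrite normrM expr2 mulrACA.
    by have [_ /(_ i j)[h1 _ _]] := bf n x; have [_ /(_ j i)[h2 _ _]] := bf n x; exact: ler_pM.
  - by [].
exists f_, (C + D); split.
- exact: addr_ge0.
- move=> n; have [C2f sf] := Cf n; split => //; first exact: (C2_supp_compact n.+1%:R).
  have [M M0 fM] := supp_bounded _ _ (cfn n) sf.
  have [M' M'0 fM'] := supp_bounded _ _ (cGn n) (generator_supp _ _ sf).
  exists (M + M') => x; split.
    by apply: (le_trans (fM x)); rewrite lerDl.
  by apply: (le_trans (fM' x)); rewrite lerDr.
- exact: cf.
- move=> n x; split.
    by have [h _] := bf n x; apply: (le_trans h); rewrite ler_wpM2r// lerDl.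
  by apply: (le_trans (Gb n x)); rewrite ler_wpM2r// lerDr.
- rewrite (_ : (fun n => _) = fun n => - (k%:R * \sum_i \sum_j A j i *
      \int[mu]_x (partial i (f_ n) x * partial j (f_ n) x))); last first.
    by apply/funext => n; have [C2f sf] := Cf n; exact: (generator_form n.+1%:R).
  apply: cvgN; rewrite -[X in _ --> X]mulr1; apply: cvgM; first exact: cvg_cst.
  (* This is A : Sigma = 1, the point at which [Lam] disappears from the limit. *)
  have -> : 1 = \sum_i \sum_j A j i * score2 i j.
    rewrite -(mulVf LS0) {2}/ddot mulr_sumr; apply: eq_bigr => i _.
    by rewrite mulr_sumr; apply: eq_bigr => j _; rewrite !mxE mulrA -score_covarianceE mxE.
  apply: cvg_sumr => i; apply: cvg_sumr => j; apply: cvgM; first exact: cvg_cst.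
  exact: cdf_cvg.
Qed.

End generator.

End generator_core.

(** * Orthogonality to initial observables *)

Section orthogonality.
Context d d' (T : measurableType d) (S : measurableType d') (R : realType).
Variables (P : probability T R) (Y : T -> S) (N : T -> R).
Hypothesis mY : measurable_fun [set: T] Y.
Hypothesis iN : integ P N.
Hypothesis N0 : forall B, measurable B -> \int[P]_(x in Y @^-1` B) N x = 0.

(* Discrete layer cake: for [0 <= t <= n] the number of levels [1, ..., n] below [t] is
   within 1 of [t]. *)
Let level_count n (t : R) : R := \sum_(j < n) (j.+1%:R <= t)%R%:R.

Let level_countP n (t : R) : 0 <= t -> [/\ level_count n t <= n%:R, level_count n t <= t &
  (t <= level_count n t + 1) || (level_count n t == n%:R)].
Proof.
move=> t0; rewrite /level_count; elim: n => [|n [IH1 IH2 IH3]].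
  by rewrite big_ord0; split => //; rewrite eqxx orbT.
rewrite big_ord_recr /=; move: IH1 IH2 IH3; move: (\sum_(i < n) _) => s s1 s2 s3.
have [nt|tn] /= := leP (n.+1%:R : R) t; rewrite ?addr0.
  have sn : s = n%:R.
    case/orP: s3 => [h|/eqP//]; apply/eqP; rewrite eq_le s1 /=.
    by move: nt; rewrite -natr1; lra.
  by rewrite sn natr1; split => //; rewrite eqxx orbT.
split => //; first by rewrite (le_trans s1)// ler_nat.
apply/orP; left; case/orP: s3 => // /eqP ->.
by rewrite natr1 ltW.
Qed.

Let nonneg_orthogonal (h : S -> R) (M : R) : measurable_fun [set: S] h ->
  (forall x, 0 <= h x <= M) -> \int[P]_x (h (Y x) * N x) = 0.
Proof.
move=> mh hM.
have mhY : measurable_fun setT (h \o Y) by exact: measurableT_comp.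
have [->|/set0P[w0 _]] := eqVneq [set: T] set0; first by rewrite Rintegral_set0.
have M0 : 0 <= M by have /andP[h1 h2] := hM (Y w0); exact: le_trans h2.
have ihN : integ P (fun x => h (Y x) * N x).
  apply: (@integ_le _ _ _ _ _ (fun x => M * `|N x|)).
  - by apply: measurable_funM => //; exact: integ_meas iN.
  - move=> x; have /andP[h1 h2] := hM (Y x).
    by rewrite normrM ger0_norm// ler_wpM2r.
  - by apply: integZ; exact: integ_norm.
have bound n : `|\int[P]_x (h (Y x) * N x) - 0| <= ((M + 1) * \int[P]_x `|N x|) * n.+1%:R^-1.
  (* The n + 1 levels spaced by c reach M + 1, above the range of [h], so the staircase stays within
     c of [h]. *)
  pose c := (M + 1) * n.+1%:R^-1; have c0 : 0 < c by rewrite mulr_gt0 ?invr_gt0// ltr_wpDl.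
  pose B (j : 'I_n.+1) := [set x : S | j.+1%:R * c <= h x].
  have mB j : measurable (B j).
    rewrite [X in measurable X](_ : _ = h @^-1` `[j.+1%:R * c, +oo[%classic); last first.
      by apply/seteqP; split => x /=; rewrite in_itv/= andbT.
    by rewrite -[X in measurable X]setTI; apply: mh => //; exact: measurable_itv.
  have i1 j : integ P (fun x => \1_(B j) (Y x) * N x).
    apply: (@integ_le _ _ _ _ _ (fun x => `|N x|)); last exact: integ_norm.
      apply: measurable_funM; last exact: integ_meas iN.
      by apply: (measurableT_comp _ mY); exact: measurable_indic.
    move=> x; rewrite normrM ler_piMl// indicE ger0_norm//.
    by case: (_ \in _).
  have z1 j : \int[P]_x (\1_(B j) (Y x) * N x) = 0.
    rewrite -(N0 _ (mB j)) [RHS]Rintegral_mkcond; apply: eq_Rintegral => x _.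
    rewrite patchE indicE.
    have -> : (x \in Y @^-1` B j) = (Y x \in B j) by apply/idP/idP; rewrite !inE.
    by case: ifP => _; rewrite ?mul1r ?mul0r.
  have zs : \int[P]_x (\sum_(j < n.+1) c * (\1_(B j) (Y x) * N x)) = 0.
    by rewrite (Rintegral_sum _ i1) big1// => j _; rewrite z1 mulr0.
  have is1 : integ P (fun x => \sum_(j < n.+1) c * (\1_(B j) (Y x) * N x)).
    by apply: integ_sum => j; exact: integZ.
  rewrite -[X in _ - X]zs -RintegralB//.
  apply: (le_trans (le_normr_Rintegral _ _)) => //; first exact: integB.
  have -> : (M + 1) * \int[P]_x `|N x| * n.+1%:R^-1 = c * \int[P]_x `|N x| by rewrite /c; ring.
  rewrite -RintegralZl//; last exact: integ_norm.
  apply: le_Rintegral => //; first by apply: integ_norm; exact: integB.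
    by apply: integZ; exact: integ_norm.
  move=> x _; have /andP[h1 h2] := hM (Y x).
  have -> : \sum_(j < n.+1) c * (\1_(B j) (Y x) * N x) = c * level_count n.+1 (h (Y x) / c) * N x.
    rewrite /level_count mulr_sumr mulr_suml; apply: eq_bigr => j _.
    rewrite mulrA; congr (_ * _ * _); rewrite indicE; congr (_%:R).
    rewrite ler_pdivlMr//; congr nat_of_bool.
    by apply/idP/idP; rewrite inE.
  rewrite -mulrBl normrM ler_wpM2r//.
  have t0 : 0 <= h (Y x) / c by rewrite divr_ge0// ltW.
  have [l1 l2 l3] := level_countP n.+1 _ t0.
  have -> : h (Y x) - c * level_count n.+1 (h (Y x) / c) = c * (h (Y x) / c - level_count n.+1 (h (Y x) / c)).
    by rewrite mulrBr mulrCA divff ?mulr1// gt_eqF.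
  rewrite normrM gtr0_norm// ler_piMr ?(ltW c0)//.
  rewrite ger0_norm ?subr_ge0// lerBlDl.
  case/orP: l3 => [|/eqP ->]; first by rewrite addrC.
  have nc : n.+1%:R * c = M + 1 by rewrite /c mulrCA divff ?mulr1// pnatr_eq0.
  rewrite ler_pdivrMr// mulrDl nc mul1r; apply: (le_trans h2).
  have c0' := ltW c0; clearbody c; lra.
have cz := cvg_harmonic_bound (fun=> \int[P]_x (h (Y x) * N x)) 0 _ bound.
exact: (cvg_unique (@norm_hausdorff R R) (cvg_cst _) cz).
Qed.

(** The hypothesis on [N] says that its conditional expectation given [Y] is 0. Adding the constant
    [M] reduces the claim to nonnegative [h]. *)
Lemma orthogonal_of_indicators (h : S -> R) (M : R) : measurable_fun [set: S] h ->
  (forall x, `|h x| <= M) -> \int[P]_x (h (Y x) * N x) = 0.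
Proof.
move=> mh hM.
have h1 : \int[P]_x ((h (Y x) + M) * N x) = 0.
  apply: (nonneg_orthogonal (fun y => h y + M) (M + M)).
    by apply: measurable_funD => //; exact: measurable_cst.
  move=> x; have := hM x; rewrite ler_norml => /andP[a b]; apply/andP; split; lra.
have hT : \int[P]_x N x = 0 by rewrite -[RHS](N0 _ measurableT) preimage_setT.
have iN' : integ P (fun x => h (Y x) * N x).
  apply: (@integ_le _ _ _ _ _ (fun x => M * `|N x|)).
  - by apply: measurable_funM; [exact: measurableT_comp|exact: integ_meas iN].
  - by move=> x; rewrite normrM ler_wpM2r.
  - by apply: integZ; exact: integ_norm.
rewrite -h1; transitivity (\int[P]_x (h (Y x) * N x) + \int[P]_x (M * N x)).
  by rewrite RintegralZl// hT mulr0 addr0.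
rewrite -RintegralD//; last exact: integZ.
by apply: eq_Rintegral => x _; rewrite mulrDl.
Qed.

End orthogonality.

(** * Quadratic increments *)

Section stationary_martingale_problem.
Context {d : measure_display} {T : measurableType d} {R : realType} {k : nat}.
Variables (P : probability T R) (mu : probability 'rV[R]_k R).
Variable X : R -> {RV P >-> 'rV[R]_k}.
Hypothesis law : forall t, 0 <= t -> forall B, measurable B -> distribution P (X t) B = mu B.

Lemma mX t : measurable_fun [set: T] (X t).
Proof. exact: measurable_funP. Qed.

Lemma integ_law t (h : 'rV[R]_k -> R) : 0 <= t -> integ mu h -> integ P (fun z => h (X t z)).
Proof.
move=> t0 ih; have mh := integ_meas ih.
apply/integrableP; split.
  by apply/measurable_EFinP; apply: measurableT_comp => //; exact: mX.
have mh' : measurable_fun setT (fun x => `|(h x)%:E|%E).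
  by apply: measurableT_comp => //; exact/measurable_EFinP.
have -> : (\int[P]_z `|(EFin \o (fun z => h (X t z))) z| =
   \int[distribution P (X t)]_x `|(h x)%:E|)%E.
  by rewrite ge0_integral_distribution.
rewrite (eq_measure_integral mu); first by case/integrableP: ih.
by move=> A mA _; exact: law.
Qed.

Lemma Rintegral_law t (h : 'rV[R]_k -> R) : 0 <= t -> integ mu h ->
  \int[P]_z h (X t z) = \int[mu]_x h x.
Proof.
move=> t0 ih; have mh := integ_meas ih; rewrite /Rintegral; congr fine.
have -> : (\int[P]_z (h (X t z))%:E = \int[distribution P (X t)]_x (h x)%:E)%E.
  rewrite integral_distribution//; first exact/measurable_EFinP.
  exact: integ_law.
by apply: eq_measure_integral => A mA _; exact: law.
Qed.

Definition increment2 (f : 'rV[R]_k -> R) (t : R) : R :=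
  \int[P]_z (f (X t z) - f (X 0 z)) ^+ 2.

Section one_function.
Variables (f g : 'rV[R]_k -> R) (M K : R).
Hypothesis paths : forall z, {within `[0, +oo[, continuous (fun t => X t z)}.
Hypotheses (cf : continuous f) (cg : continuous g).
Hypotheses (fM : forall x, `|f x| <= M) (gM : forall x, `|g x| <= M).
Hypothesis mart : is_martingale P (natural_filtration X)
  (fun t z => f (X t z) - f (X 0 z) - \int[@lebesgue_measure R]_(u in `[0, t]) g (X u z)).
Hypotheses (fK : \int[mu]_x (f x ^+ 2) <= K) (gK : \int[mu]_x (g x ^+ 2) <= K).

Let I t z := \int[@lebesgue_measure R]_(u in `[0, t]) g (X u z).
Let J t := \int[P]_z (f (X 0 z) * I t z).

Let M0 : 0 <= M.
Proof. exact: le_trans (fM 0). Qed.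

Let mf : measurable_fun setT f.
Proof. exact: continuous_measurable_rV. Qed.

Let mg : measurable_fun setT g.
Proof. exact: continuous_measurable_rV. Qed.

Let integ_bounded (h : T -> R) (C : R) : measurable_fun setT h -> (forall z, `|h z| <= C) ->
  integ P h.
Proof. by move=> mh hC; apply: (integ_le mh hC); exact: finite_measure_integrable_cst. Qed.

Let integ_mu_bounded (h : 'rV[R]_k -> R) (C : R) : measurable_fun setT h ->
  (forall x, `|h x| <= C) -> integ mu h.
Proof. by move=> mh hC; apply: (integ_le mh hC); exact: finite_measure_integrable_cst. Qed.

Let mcomp (h : 'rV[R]_k -> R) t : measurable_fun setT h -> measurable_fun setT (fun z => h (X t z)).
Proof. by move=> mh; apply: measurableT_comp => //; exact: mX. Qed.

Let path_cont z : {within `[0, +oo[, continuous (fun t => g (X t z))}.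
Proof.
move=> t; exact: (cvg_comp _ _ (paths z t) (cg (X t z))).
Qed.

Let path_int z t : (@lebesgue_measure R).-integrable `[0, t] (EFin \o (fun u => g (X u z))).
Proof.
apply: continuous_compact_integrable; first exact: segment_compact.
apply: continuous_subspaceW (path_cont z).
by move=> u /=; rewrite !in_itv/= andbT => /andP[].
Qed.

Let I0 z : I 0 z = 0.
Proof. by rewrite /I set_itv1 Rintegral_set1. Qed.

Let I_le z t : 0 <= t -> `|I t z| <= M * t.
Proof.
move=> t0; rewrite /I; apply: (le_trans (le_normr_Rintegral _ _)) => //.
have -> : M * t = \int[@lebesgue_measure R]_(u in `[0, t]) M.
  rewrite Rintegral_cst//= lebesgue_measure_itv/= lte_fin; case: ifPn => [_|]; first by rewrite sube0.
  by rewrite -leNgt => t0'; have -> : t = 0 by apply/eqP; rewrite eq_le t0 t0'.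
apply: le_Rintegral => //.
- exact: integrable_norm (path_int z t).
- apply: continuous_compact_integrable; first exact: segment_compact.
  by apply: continuous_subspaceT; exact: contC.
Qed.

Let integ_N t : 0 <= t -> integ P (fun z => f (X t z) - f (X 0 z) - I t z).
Proof. by move=> t0; have [_ h _] := mart; exact: h. Qed.

(** Read off the martingale, which is measurable by assumption; this avoids joint measurability of
    the process in time and sample point. *)
Let mI t : 0 <= t -> measurable_fun setT (I t).
Proof.
move=> t0; rewrite (_ : I t = fun z => (f (X t z) - f (X 0 z)) - (f (X t z) - f (X 0 z) - I t z)).
  apply: measurable_funB; last exact: integ_meas (integ_N _ t0).
  by apply: measurable_funB; exact: mcomp.
by apply/funext => z; rewrite opprB addrC subrK.
Qed.

Let integ_fI t : 0 <= t -> integ P (fun z => f (X 0 z) * I t z).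
Proof.
move=> t0; apply: (integ_bounded _ (M * (M * t))).
  by apply: measurable_funM; [exact: mcomp|exact: mI].
by move=> z; rewrite normrM ler_pM// I_le.
Qed.

Let martJ t : 0 <= t -> \int[P]_z (f (X 0 z) * (f (X t z) - f (X 0 z))) = J t.
Proof.
move=> t0.
have N0 B : measurable B -> \int[P]_(z in X 0 @^-1` B) (f (X t z) - f (X 0 z) - I t z) = 0.
  move=> mB; have [_ _ h] := mart.
  (* The event that X_0 lies in [B] belongs to the filtration at time 0, where the martingale is
     0. *)
  have := h 0 t (lexx 0) t0 (X 0 @^-1` B); rewrite /Rintegral => ->.
    rewrite (eq_integral (fun=> 0%E)) ?integral0// => z _.
    by rewrite subrr -[X in _ - X]/(I 0 z) I0 subr0.
  apply: sub_gen_smallest; exists 0 => /=; first by rewrite in_itv/= lexx.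
  by exists B.
have := orthogonal_of_indicators _ _ _ _ _ P (X 0) _ (mX 0) (integ_N _ t0) N0 f M mf fM.
have -> : \int[P]_z (f (X 0 z) * (f (X t z) - f (X 0 z) - I t z)) =
   \int[P]_z (f (X 0 z) * (f (X t z) - f (X 0 z))) - J t.
  rewrite /J -RintegralB//; last exact: integ_fI.
    by apply: eq_Rintegral => z _; rewrite mulrBr.
  apply: (integ_bounded _ (M * (M + M))).
    by apply: measurable_funM; [exact: mcomp|apply: measurable_funB; exact: mcomp].
  by move=> z; rewrite normrM ler_pM// (le_trans (ler_normB _ _))// lerD.
by move=> /eqP; rewrite subr_eq0 => /eqP.
Qed.

Let ifM2 (h1 h2 : 'rV[R]_k -> R) s t : measurable_fun setT h1 -> measurable_fun setT h2 ->
  (forall x, `|h1 x| <= M) -> (forall x, `|h2 x| <= M) ->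
  integ P (fun z => h1 (X s z) * h2 (X t z)).
Proof.
move=> m1 m2 b1 b2; apply: (integ_bounded _ (M * M)).
  by apply: measurable_funM; exact: mcomp.
by move=> z; rewrite normrM ler_pM.
Qed.

Let imuM2 (h1 h2 : 'rV[R]_k -> R) : measurable_fun setT h1 -> measurable_fun setT h2 ->
  (forall x, `|h1 x| <= M) -> (forall x, `|h2 x| <= M) -> integ mu (fun x => h1 x * h2 x).
Proof.
move=> m1 m2 b1 b2; apply: (integ_mu_bounded _ (M * M)); first exact: measurable_funM.
by move=> z; rewrite normrM ler_pM.
Qed.

(** After expanding the square, stationarity makes the second moments at times 0 and t equal. *)
Let increment2E t : 0 <= t -> increment2 f t = - 2 * J t.
Proof.
move=> t0; rewrite -martJ// /increment2.
pose m := \int[mu]_x (f x * f x).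
have E s : 0 <= s -> \int[P]_z (f (X s z) * f (X s z)) = m.
  by move=> s0; rewrite (Rintegral_law s (fun x => f x * f x))//; exact: imuM2.
have E1 : \int[P]_z (f (X 0 z) * (f (X t z) - f (X 0 z))) =
    \int[P]_z (f (X 0 z) * f (X t z)) - m.
  rewrite -(E 0)// -RintegralB//; [|exact: ifM2|exact: ifM2].
  by apply: eq_Rintegral => z _; rewrite mulrBr.
rewrite E1; transitivity (\int[P]_z ((f (X t z) * f (X t z) + f (X 0 z) * f (X 0 z)) -
    2 * (f (X 0 z) * f (X t z)))).
  by apply: eq_Rintegral => z _; ring.
rewrite RintegralB//; [|by apply: integD; exact: ifM2|by apply: integZ; exact: ifM2].
rewrite RintegralD//; [|exact: ifM2|exact: ifM2].
rewrite RintegralZl//; last exact: ifM2.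
by rewrite !E//; ring.
Qed.

(** The fundamental theorem of calculus along each path, then differentiation under the expectation
    with dominating constant [M * M]. This takes the place of exchanging expectation and time
    integral. *)
Let J_derive (t : R) : 0 < t -> is_derive t (1 : R) J (\int[P]_z (f (X 0 z) * g (X t z))).
Proof.
move=> t0.
pose F (s : R) (z : T) := f (X 0 z) * I s z.
have dI (s : R) z : 0 < s -> derivable (I ^~ z) s 1 /\ derive1 (I ^~ z) s = g (X s z).
  move=> s0; apply: (@continuous_FTC1_closed R (fun u => g (X u z)) 0 s (s + 1)) => //.
  - by rewrite ltrDl.
  - apply: (@within_continuous_continuous _ _ _ 0 (s + 1)).
    + by rewrite addr_gt0.
    + apply: continuous_subspaceW (path_cont z).
      by move=> u /=; rewrite !in_itv/= andbT => /andP[].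
    + by rewrite in_itv/= s0 ltrDl ltr01.
have dF (s : R) z : 0 < s -> is_derive s (1 : R) (F ^~ z : R -> R) (f (X 0 z) * g (X s z)).
  move=> s0; have [d1 d2] := dI s z s0.
  have d3 : is_derive s (1 : R) (I ^~ z : R -> R) (g (X s z)) by apply: (DeriveDef d1); rewrite -derive1E.
  have d0 : is_derive s (1 : R) (cst (f (X 0 z)) : R -> R) 0 by exact: is_derive_cst.
  have d4 := is_deriveM d0 d3; rewrite scaler0 addr0 in d4; exact: d4.
have h1 : t \in `]0, (t + 1)[ by rewrite in_itv/= t0 ltrDl ltr01.
have pos s : `]0, (t + 1)[%classic s -> 0 < s by rewrite /= in_itv/= => /andP[].
have h2 s : `]0, (t + 1)[%classic s -> P.-integrable setT (EFin \o F s).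
  by move=> /pos s0; apply: integ_fI; exact: ltW.
have h3 s z : `]0, (t + 1)[%classic s -> [set: T] z -> derivable (F ^~ z) s 1.
  by move=> /pos s0 _; have [] := dF s z s0.
have d1E s z : 0 < s -> partial1of2 F s z = f (X 0 z) * g (X s z).
  by move=> s0; rewrite partial1of2E; have [_ ->] := dF s z s0.
have h4 s z : `]0, (t + 1)[%classic s -> [set: T] z -> `|partial1of2 F s z| <= M * M.
  by move=> /pos s0 _; rewrite d1E// normrM ler_pM.
have iMM : P.-integrable setT (EFin \o (fun _ : T => M * M)).
  exact: finite_measure_integrable_cst.
have MM0 (z : T) : 0 <= M * M by rewrite mulr_ge0.
split.
  exact: (@derivable_under_integral _ _ _ P F _ measurableT t 0 (t + 1) h1 h2 h3 _ MM0 iMM h4).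
rewrite -derive1E.
rewrite (@differentiation_under_integral _ _ _ P F _ measurableT t 0 (t + 1) h1 h2 h3 _ MM0 iMM h4).
by apply: eq_Rintegral => z _; exact: d1E.
Qed.

Let J_le t : 0 <= t -> `|J t| <= M * M * t.
Proof.
move=> t0; apply: (le_trans (le_normr_Rintegral _ _)) => //; first exact: integ_fI.
have -> : M * M * t = \int[P]_z (M * M * t).
  by rewrite Rintegral_cst// [X in fine X]probability_setT mulr1.
apply: le_Rintegral => //.
- by apply: integ_norm; exact: integ_fI.
- exact: finite_measure_integrable_cst.
- by move=> z _; rewrite normrM -mulrA ler_pM// I_le.
Qed.

Let J0 : J 0 = 0.
Proof. by apply/eqP; rewrite -normr_le0 (le_trans (J_le 0 (lexx 0)))// mulr0. Qed.

(** For two-sided continuity at 0. If s < 0 the interval of integration is empty and [J s] is 0. *)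
Let J_abs s : `|J s| <= M * M * `|s|.
Proof.
have [s0|s0] := leP 0 s; first by rewrite (ger0_norm s0); exact: J_le.
have -> : J s = \int[P]_z (0 : R).
  apply: eq_Rintegral => z _; rewrite /I set_itv_ge ?Rintegral_set0 ?mulr0//.
  by rewrite -leNgt bnd_simp.
by rewrite Rintegral0 normr0 !mulr_ge0.
Qed.

(** The intermediate time [c] is unknown, which is harmless: stationarity makes the later estimates
    uniform over c in ]0, h[. *)
Let J_mvt h : 0 < h -> exists2 c, 0 < c < h & J h = h * \int[P]_z (f (X 0 z) * g (X c z)).
Proof.
move=> h0.
have cJ : {within `[0, h], continuous J}.
  apply: continuous_in_subspaceT => t; rewrite inE/= in_itv/= => /andP[t0 th].
  have [t_gt0|] := ltP 0 t.
    apply: differentiable_continuous; apply/derivable1_diffP.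
    by have [] := J_derive t t_gt0.
  move=> t0'; have -> : t = 0 by apply/eqP; rewrite eq_le t0 t0'.
  apply/cvgrPdist_le => /= e e0.
  have C0 : 0 < M * M + 1 by rewrite ltr_wpDl// mulr_ge0.
  have eC : 0 < e / (M * M + 1) by rewrite divr_gt0.
  apply: filterS (@nbhs0_le _ R^o _ eC) => s hs.
  rewrite J0 sub0r normrN; apply: (le_trans (J_abs s)).
  apply: (@le_trans _ _ ((M * M + 1) * `|s|)); first by rewrite ler_wpM2r// lerDl.
  by rewrite mulrC -ler_pdivlMr.
have dJ (t : R) : t \in `]0, h[ -> is_derive t (1 : R) J (\int[P]_z (f (X 0 z) * g (X t z))).
  by rewrite in_itv/= => /andP[t0 _]; exact: J_derive.
have [c] := @MVT R J (fun t => \int[P]_z (f (X 0 z) * g (X t z))) 0 h h0 dJ cJ.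
rewrite in_itv/= J0 !subr0 => ch ->.
by exists c => //; rewrite mulrC.
Qed.

Let ff_le : \int[mu]_x (f x * f x) <= K.
Proof. by apply: le_trans fK; rewrite le_eqVlt; apply/orP; left; apply/eqP; apply: eq_Rintegral. Qed.

Let gg_le : \int[mu]_x (g x * g x) <= K.
Proof. by apply: le_trans gK; rewrite le_eqVlt; apply/orP; left; apply/eqP; apply: eq_Rintegral. Qed.

Let cross_le (t : R) : 0 <= t -> `|\int[P]_z (f (X 0 z) * g (X t z))| <= K.
Proof.
move=> t0; apply: (le_trans (le_normr_Rintegral _ _)) => //; first exact: ifM2.
apply: (@le_trans _ _ (\int[P]_z (2^-1 * (f (X 0 z) * f (X 0 z) + g (X t z) * g (X t z))))).
  apply: le_Rintegral => //.
  - by apply: integ_norm; exact: ifM2.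
  - by apply: integZ; apply: integD; exact: ifM2.
  - by move=> z _; rewrite [leRHS]mulrC -!expr2; exact: normM_le_sqr.
rewrite RintegralZl//; last by apply: integD; exact: ifM2.
rewrite RintegralD//; [|exact: ifM2|exact: ifM2].
rewrite (Rintegral_law 0 (fun x => f x * f x))//; last exact: imuM2.
rewrite (Rintegral_law t (fun x => g x * g x))//; last exact: imuM2.
by rewrite ler_pdivrMl//; have := ff_le; have := gg_le; lra.
Qed.

Lemma increment2_le (t : R) : 0 <= t -> increment2 f t <= 2 * K * t.
Proof.
rewrite le_eqVlt => /orP[/eqP <-|t0]; first by rewrite increment2E// J0 !mulr0.
rewrite (increment2E t (ltW t0)); have [c /andP[c0 _] ->] := J_mvt t t0.
have := cross_le c (ltW c0); rewrite ler_norml => /andP[h _].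
rewrite -subr_ge0 (_ : _ - _ = 2 * t * (\int[P]_z (f (X 0 z) * g (X c z)) - - K)); last by ring.
by rewrite mulr_ge0 ?subr_ge0// mulr_ge0// ltW.
Qed.

Lemma increment2_estimate (t : R) : 0 < t ->
  `|increment2 f t + 2 * t * \int[mu]_x (f x * g x)| <= 3 * K * t * Num.sqrt t.
Proof.
move=> t0; rewrite (increment2E t (ltW t0)); have [c /andP[c0 ct] ->] := J_mvt t t0.
set s := Num.sqrt t; have s0 : 0 < s by rewrite sqrtr_gt0.
have ss : s * s = t by rewrite -expr2 sqr_sqrtr// ltW.
have c0' := ltW c0; have t0' := ltW t0; have s0' := ltW s0.
(* Stationarity moves the limiting term to time [c], so that only an increment of [f] remains,
   paired with [g (X c z)]. *)
rewrite -(Rintegral_law c (fun x => f x * g x))//; last exact: imuM2.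
have -> : - 2 * (t * \int[P]_z (f (X 0 z) * g (X c z))) + 2 * t * \int[P]_z (f (X c z) * g (X c z)) =
   2 * t * \int[P]_z ((f (X c z) - f (X 0 z)) * g (X c z)).
  transitivity (2 * t * (\int[P]_z (f (X c z) * g (X c z)) - \int[P]_z (f (X 0 z) * g (X c z)))).
    by ring.
  congr (_ * _); rewrite -RintegralB//; [|exact: ifM2|exact: ifM2].
  by apply: eq_Rintegral => z _; rewrite mulrBl.
rewrite normrM ger0_norm; last by rewrite mulr_ge0.
(* With weight s = sqrt t the square increment, at most 2 K c <= 2 K t, contributes 2 K s, and the
   square of [g] contributes s K. *)
have -> : 3 * K * t * s = 2 * t * (2^-1 * (2 * K * s + s * K)) by field.
rewrite ler_wpM2l ?mulr_ge0//.
have idf2 : integ P (fun z => (f (X c z) - f (X 0 z)) ^+ 2).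
  apply: (integ_bounded _ ((M + M) ^+ 2)).
    by apply: measurable_funX; apply: measurable_funB; exact: mcomp.
  move=> z; rewrite normrX lerXn2r ?nnegrE ?addr_ge0//.
  by rewrite (le_trans (ler_normB _ _))// lerD.
have idfg : integ P (fun z => (f (X c z) - f (X 0 z)) * g (X c z)).
  apply: (integ_bounded _ ((M + M) * M)).
    by apply: measurable_funM; [apply: measurable_funB; exact: mcomp|exact: mcomp].
  move=> z; rewrite normrM ler_pM//.
  by rewrite (le_trans (ler_normB _ _))// lerD.
apply: (le_trans (le_normr_Rintegral _ _)) => //.
apply: (@le_trans _ _ (\int[P]_z (2^-1 * (s^-1 * (f (X c z) - f (X 0 z)) ^+ 2 + s * (g (X c z) * g (X c z)))))).
  apply: le_Rintegral => //.
  - exact: integ_norm.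
  - by apply: integZ; apply: integD; apply: integZ => //; exact: ifM2.
  - move=> z _; exact: normM_le_weighted.
rewrite RintegralZl//; last by apply: integD; apply: integZ => //; exact: ifM2.
rewrite ler_wpM2l ?invr_ge0//.
rewrite RintegralD//; [|exact: integZ|by apply: integZ; exact: ifM2].
have -> : \int[P]_z (s^-1 * (f (X c z) - f (X 0 z)) ^+ 2) = s^-1 * increment2 f c.
  by rewrite RintegralZl.
have -> : \int[P]_z (s * (g (X c z) * g (X c z))) = s * \int[mu]_x (g x * g x).
  rewrite RintegralZl//; last exact: ifM2.
  by rewrite (Rintegral_law c (fun x => g x * g x))//; exact: imuM2.
have K0 : 0 <= K by apply: le_trans ff_le; apply: Rintegral_ge0 => x _; rewrite -expr2 sqr_ge0.
apply: lerD; last by rewrite ler_wpM2l// gg_le.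
rewrite ler_pdivrMl// (_ : s * (2 * K * s) = 2 * K * (s * s)); last by ring.
by rewrite ss; apply: (le_trans (increment2_le c c0')); rewrite ler_wpM2l ?mulr_ge0// ltW.
Qed.

End one_function.
End stationary_martingale_problem.

(** * Passage to the limit *)

Section law_of_stationary_process.
Context {d : measure_display} {T : measurableType d} {R : realType} {k : nat}.
Variables (P : probability T R) (mu : probability 'rV[R]_k R).
Variable X : R -> {RV P >-> 'rV[R]_k}.

Lemma stationary_law : is_stationary X ->
  (forall B, measurable B -> distribution P (X 0) B = mu B) ->
  forall t, 0 <= t -> forall B, measurable B -> distribution P (X t) B = mu B.
Proof.
move=> hs h0 t t0 B mB; rewrite -h0//.
have := hs t 1%N (fun=> 0) (fun=> B) t0 (fun=> lexx 0) (fun=> mB).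
rewrite add0r (_ : \bigcap_(i in [set: 'I_1]) _ = X t @^-1` B); last first.
  by apply/seteqP; split => z h; [exact: (h ord0)|move=> i _].
rewrite (_ : \bigcap_(i in [set: 'I_1]) _ = X 0 @^-1` B)//.
by apply/seteqP; split => z h; [exact: (h ord0)|move=> i _].
Qed.

Hypothesis law : forall t, 0 <= t -> forall B, measurable B -> distribution P (X t) B = mu B.

(** Stated for merely measurable [h], via positive and negative parts, so that [variance_law] also
    covers infinite variances. *)
Lemma integral_law t (h : 'rV[R]_k -> \bar R) : 0 <= t -> measurable_fun [set: 'rV[R]_k] h ->
  (\int[P]_z h (X t z) = \int[mu]_x h x)%E.
Proof.
move=> t0 mh.
have E (u : 'rV[R]_k -> \bar R) : measurable_fun setT u -> (forall x, 0 <= u x)%E ->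
    (\int[P]_z u (X t z) = \int[mu]_x u x)%E.
  move=> mu' u0; transitivity (\int[distribution P (X t)]_x u x)%E.
    by rewrite ge0_integral_distribution.
  by apply: eq_measure_integral => A mA _; exact: law.
rewrite integralE [RHS]integralE; congr (_ - _)%E.
  rewrite -(E _ (measurable_funepos mh))//.
  by apply: eq_integral => z _; rewrite -[LHS]/((h \o X t)^\+ z)%E funepos_comp.
rewrite -(E _ (measurable_funeneg mh))//.
by apply: eq_integral => z _; rewrite -[LHS]/((h \o X t)^\- z)%E funeneg_comp.
Qed.

Lemma expectation_law t (h : 'rV[R]_k -> R) : 0 <= t -> measurable_fun [set: 'rV[R]_k] h ->
  ('E_P[h \o X t] = 'E_mu[h])%E.
Proof.
move=> t0 mh; rewrite expectation.unlock.
have mh' : measurable_fun setT (EFin \o h) by exact/measurable_EFinP.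
exact: (integral_law t _ t0 mh').
Qed.

Lemma variance_law t (h : 'rV[R]_k -> R) : 0 <= t -> measurable_fun [set: 'rV[R]_k] h ->
  variance P (h \o X t) = variance mu h.
Proof.
move=> t0 mh; rewrite /variance covariance.unlock expectation_law//.
set m := fine _.
have mh2 : measurable_fun setT ((h \- cst m) * (h \- cst m)).
  by apply: measurable_funM; apply: measurable_funB.
by rewrite -(expectation_law t _ t0 mh2).
Qed.

End law_of_stationary_process.

Section limit_estimate.
Context {d : measure_display} {T : measurableType d} {R : realType} {k : nat}.
Variables (mu : probability 'rV[R]_k R) (p psi : 'rV[R]_k -> R) (L : R).
Hypothesis hp : has_density mu p.
Hypothesis pE : forall x, p x = expR (psi x).
Hypothesis psiE : @ln R \o p = psi.
Hypothesis dpsi : forall x, differentiable psi x.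
Hypothesis L0 : 0 < L.
Hypothesis lpsi : forall i y z, `|partial i psi y - partial i psi z| <= L * `|y - z|.
Hypothesis iw2 : integ mu (fun x => wt psi x ^+ 2).
Variables (Lam : 'M[R]_k) (P : probability T R) (X : R -> {RV P >-> 'rV[R]_k}).
Hypothesis hLam : sym_posdef Lam.
Hypothesis LS0 : ddot Lam (score_covariance mu p) != 0.
Hypothesis hX : is_diffusion (langevin_generator mu p Lam) X.
Hypothesis law : forall t, 0 <= t -> forall B, measurable B -> distribution P (X t) B = mu B.

(** [increment2_estimate] passes to the limit at each fixed t: the increments converge by
    domination, the pairings with the generator tend to -k, and the bound is independent of n. *)
Lemma log_density_increment : exists2 K, 0 <= K & forall t, 0 < t ->
  `|increment2 P X psi t - 2 * t * k%:R| <= K * t * Num.sqrt t.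
Proof.
have [f_ [C [C0 Cf cvgf bf cvge]]] :=
  core_sequence mu p psi L hp pE psiE dpsi L0 lpsi iw2 Lam hLam LS0.
have [paths mart] := hX.
have mw : measurable_fun setT (wt psi) := continuous_measurable_rV _ _ (wt_continuous psi dpsi).
(* The second moment of the dominating function, hence a bound for [f_ n] and [G (f_ n)] at once. *)
pose K := \int[mu]_x (C ^+ 2 * wt psi x ^+ 2).
have iCw : integ mu (fun x => C ^+ 2 * wt psi x ^+ 2) by exact: integZ.
have K0 : 0 <= K by apply: Rintegral_ge0 => x _; rewrite mulr_ge0// sqr_ge0.
have sqb (h : 'rV[R]_k -> R) : continuous h -> (forall x, `|h x| <= C * wt psi x) ->
    \int[mu]_x (h x ^+ 2) <= K.
  move=> ch hC; have sb x : h x ^+ 2 <= C ^+ 2 * wt psi x ^+ 2.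
    rewrite -exprMn -[leLHS]real_normK ?num_real// lerXn2r ?nnegrE//.
    exact: le_trans (hC x).
  apply: le_Rintegral => //; apply: integ_le iCw.
    by apply: measurable_funX; exact: continuous_measurable_rV.
  by move=> x; rewrite ger0_norm ?sqr_ge0.
exists (3 * K); first by rewrite mulr_ge0.
move=> t t0; have t0' := ltW t0.
have est n : `|increment2 P X (f_ n) t + 2 * t * \int[mu]_x (f_ n x * langevin_generator mu p Lam (f_ n) x)|
    <= 3 * K * t * Num.sqrt t.
  have [C2f cf cg [M fM]] := Cf n.
  have fM1 x : `|f_ n x| <= M by case: (fM x).
  have gM1 x : `|langevin_generator mu p Lam (f_ n) x| <= M by case: (fM x).
  have fK : \int[mu]_x (f_ n x ^+ 2) <= K by apply: sqb => // x; case: (bf n x).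
  have gK : \int[mu]_x (langevin_generator mu p Lam (f_ n) x ^+ 2) <= K.
    by apply: sqb => // x; case: (bf n x).
  have martn := mart _ C2f.
  exact: (increment2_estimate P mu X law (f_ n) (langevin_generator mu p Lam (f_ n))
    M K paths cf cg fM1 gM1 martn fK gK t t0).
have cD : increment2 P X (f_ n) t @[n --> \oo] --> increment2 P X psi t.
  have [||||_] := @Rintegral_dominated _ _ _ P (fun n z => (f_ n (X t z) - f_ n (X 0 z)) ^+ 2)
     (fun z => (psi (X t z) - psi (X 0 z)) ^+ 2)
     (fun z => 2 * (C ^+ 2 * wt psi (X t z) ^+ 2) + 2 * (C ^+ 2 * wt psi (X 0 z) ^+ 2)).
  - move=> n; apply: measurable_funX; have [_ cf _ _] := Cf n.
    have mf := continuous_measurable_rV _ _ cf.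
    by apply: measurable_funB; apply: measurableT_comp => //; exact: (mX P X).
  - move=> z; under eq_cvg do rewrite expr2.
    by rewrite expr2; apply: cvgM; apply: cvgB; exact: cvgf.
  - apply: integD; apply: integZ.
      exact: (integ_law P mu X law t (fun x => C ^+ 2 * wt psi x ^+ 2)).
    exact: (integ_law P mu X law 0 (fun x => C ^+ 2 * wt psi x ^+ 2)).
  - move=> n z; rewrite ger0_norm ?sqr_ge0//.
    have sb x : f_ n x ^+ 2 <= C ^+ 2 * wt psi x ^+ 2.
      have [h _] := bf n x.
      rewrite -exprMn -[leLHS]real_normK ?num_real// lerXn2r ?nnegrE//.
      exact: le_trans h.
    have := sb (X t z); have := sb (X 0 z); have := sqr_ge0 (f_ n (X t z) + f_ n (X 0 z)).
    rewrite (_ : (f_ n (X t z) - f_ n (X 0 z)) ^+ 2 = 2 * f_ n (X t z) ^+ 2 + 2 * f_ n (X 0 z) ^+ 2 -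
      (f_ n (X t z) + f_ n (X 0 z)) ^+ 2); last by ring.
    move=> h1 h2 h3; rewrite lerBlDr -[leLHS]addr0; apply: lerD => //.
    by apply: lerD; rewrite ler_wpM2l.
  - by [].
have cE : (increment2 P X (f_ n) t +
    2 * t * \int[mu]_x (f_ n x * langevin_generator mu p Lam (f_ n) x)) @[n --> \oo] -->
    increment2 P X psi t + 2 * t * (- k%:R).
  by apply: cvgD => //; apply: cvgM => //; exact: cvg_cst.
rewrite -mulrN; apply: (cvgr_to_le (cvg_norm cE)); exact: nearW.
Qed.

End limit_estimate.

Lemma score_lipschitz {R : realType} {k : nat} (psi : 'rV[R]_k -> R) (L : R) :
  L.-lipschitz (grad psi) ->
  forall i y z, `|partial i psi y - partial i psi z| <= L * `|y - z|.
Proof.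
move=> lip i y z; have := lip (y, z) (conj Logic.I Logic.I) => /= h.
apply: le_trans h; have -> : partial i psi y - partial i psi z = (grad psi y - grad psi z) i ord0.
  by rewrite !mxE.
rewrite [leRHS]/Num.norm /= mx_normrE.
exact: (le_bigmax_cond 0 (fun ij : 'I_k * 'I_1 => `|(grad psi y - grad psi z) ij.1 ij.2|)
  (j := (i, ord0))).
Qed.

(** * Autocorrelation *)

Section autocorrelation.
Context {d : measure_display} {T : measurableType d} {R : realType} {k : nat}.
Variables (P : probability T R) (mu : probability 'rV[R]_k R).
Variable X : R -> {RV P >-> 'rV[R]_k}.
Hypothesis law : forall t, 0 <= t -> forall B, measurable B -> distribution P (X t) B = mu B.
Variable psi : 'rV[R]_k -> R.
Hypothesis mpsi : measurable_fun [set: 'rV[R]_k] psi.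

Lemma correlation0 t : 0 <= t -> fine (variance mu psi) = 0 ->
  correlation P (psi \o X 0) (psi \o X t) = 0.
Proof.
move=> t0 V0; rewrite /correlation !(variance_law P mu X law)// V0.
by rewrite sqrtr0 mul0r invr0 mulr0.
Qed.

Let m := fine ('E_mu[psi])%E.

Lemma fine_varianceE : fine (variance mu psi) = \int[mu]_x (psi x - m) ^+ 2.
Proof.
rewrite /variance covariance.unlock -/m expectation.unlock /Rintegral.
by congr fine; apply: eq_integral => x _; rewrite expr2.
Qed.

(** Since [fine] sends +oo to 0, a nonzero value certifies a finite variance. The number [m] is
    finite by construction, so nothing about the mean of [psi] has to be known beforehand. *)
Lemma integ_centered2 : fine (variance mu psi) != 0 -> integ mu (fun x => (psi x - m) ^+ 2).
Proof.
rewrite fine_varianceE => V0; apply/integrableP; split.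
  by apply/measurable_EFinP; apply: measurable_funX; apply: measurable_funB.
under eq_integral do rewrite /= ger0_norm ?sqr_ge0//.
rewrite ltey; apply: contra V0 => /eqP; rewrite /Rintegral => ->.
by [].
Qed.

Lemma integ_wt2 : fine (variance mu psi) != 0 -> integ mu (fun x => wt psi x ^+ 2).
Proof.
move=> V0; have ic := integ_centered2 V0.
apply: (@integ_le _ _ _ _ _ (fun x => 2 * (psi x - m) ^+ 2 + 2 * (1 + `|m|) ^+ 2)).
- apply: measurable_funX; apply: measurable_funD => //.
  exact: measurableT_comp.
- move=> x; rewrite [leLHS]ger0_norm ?sqr_ge0// /wt.
  have h : `|psi x| <= `|psi x - m| + `|m| by rewrite -[psi x in X in X <= _](subrK m) ler_normD.
  rewrite -[(psi x - m) ^+ 2]real_normK ?num_real//.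
  have a0 := normr_ge0 (psi x); have b0 := normr_ge0 (psi x - m); have c0 := normr_ge0 m.
  move: `|psi x| `|psi x - m| `|m| h a0 b0 c0 => a b c h a0 b0 c0.
  apply: (@le_trans _ _ ((b + (1 + c)) ^+ 2)).
    by rewrite lerXn2r ?nnegrE; lra.
  have -> : 2 * b ^+ 2 + 2 * (1 + c) ^+ 2 = (b + (1 + c)) ^+ 2 + (b - (1 + c)) ^+ 2 by ring.
  by rewrite lerDl sqr_ge0.
- apply: integD; first exact: integZ.
  exact: finite_measure_integrable_cst.
Qed.

(** Polarisation of the centred variables, which have variance V at both times by stationarity. *)
Lemma correlation_increment t : 0 <= t -> fine (variance mu psi) != 0 ->
  correlation P (psi \o X 0) (psi \o X t) =
    1 - increment2 P X psi t / (2 * fine (variance mu psi)).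
Proof.
move=> t0 V0; have ic := integ_centered2 V0.
have VE := fine_varianceE; set V := fine _ in V0 VE *.
have V_ge0 : 0 <= V by rewrite VE; apply: Rintegral_ge0 => x _; exact: sqr_ge0.
rewrite /correlation !(variance_law P mu X law)// -/V -expr2 sqr_sqrtr//.
pose u s z := psi (X s z) - m.
have mu_ s : measurable_fun setT (u s).
  by apply: measurable_funB => //; apply: measurableT_comp => //; exact: (mX P X).
have iu s : 0 <= s -> integ P (fun z => u s z ^+ 2).
  by move=> s0; exact: (integ_law P mu X law s (fun x => (psi x - m) ^+ 2)).
have iuu : integ P (fun z => u 0 z * u t z).
  apply: (@integ_le _ _ _ _ _ (fun z => 2^-1 * (u 0 z ^+ 2 + u t z ^+ 2))).
  - exact: measurable_funM.
  - by move=> z; rewrite [leRHS]mulrC; exact: normM_le_sqr.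
  - by apply: integZ; apply: integD; exact: iu.
have Eu s : 0 <= s -> \int[P]_z u s z ^+ 2 = V.
  by move=> s0; rewrite VE; exact: (Rintegral_law P mu X law s (fun x => (psi x - m) ^+ 2)).
have -> : fine (covariance P (psi \o X 0) (psi \o X t)) = \int[P]_z (u 0 z * u t z).
  rewrite covariance.unlock !(expectation_law P mu X law)// -/m expectation.unlock.
  by congr fine; apply: eq_integral.
have -> : increment2 P X psi t = 2 * V - 2 * \int[P]_z (u 0 z * u t z).
  rewrite /increment2.
  transitivity (\int[P]_z ((u t z ^+ 2 + u 0 z ^+ 2) - 2 * (u 0 z * u t z))).
    by apply: eq_Rintegral => z _; rewrite /u; ring.
  rewrite RintegralB//; [|by apply: integD; exact: iu|exact: integZ].
  rewrite RintegralD//; [|exact: iu|exact: iu].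
  by rewrite RintegralZl// !Eu//; ring.
by field.
Qed.

End autocorrelation.

Theorem corollary2p11 (R : realType) (k : nat)
    (mu : probability 'rV[R]_k R) (p : 'rV[R]_k -> R)
    (hp : has_density mu p) (hlip : lipschitz_log_gradient p)
    (Lam : 'M[R]_k) (hLam : sym_posdef Lam)
    (d : measure_display) (T : measurableType d) (P : probability T R)
    (X : R -> {RV P >-> 'rV[R]_k})
    (hX : is_diffusion (langevin_generator mu p Lam) X)
    (hstat : is_stationary X)
    (hX0 : forall B : set 'rV[R]_k, measurable B ->
       distribution P (X 0) B = mu B) :
  let autocorr (t : R) :=
    correlation P (@ln R \o p \o X 0) (@ln R \o p \o X t) in
  h^-1 * (autocorr h - autocorr 0) @[h --> 0^'+] -->
    - (k%:R / fine (variance mu (@ln R \o p))).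
Proof.
move=> autocorr; have law := stationary_law P mu X hstat hX0.
have [p_gt0 dpsi [L' lipL]] := hlip.
pose psi := @ln R \o p.
have pE x : p x = expR (psi x) by rewrite /psi /= lnK// posrE.
(* Made strictly positive because [dpsi_sqr] divides by k L. *)
pose L := `|L'| + 1; have L0 : 0 < L by rewrite ltr_wpDl.
have lpsi i y z : `|partial i psi y - partial i psi z| <= L * `|y - z|.
  apply: (le_trans (score_lipschitz psi L' lipL i y z)).
  by rewrite ler_wpM2r// (le_trans (ler_norm _))// lerDl.
have mpsi : measurable_fun setT psi by apply: continuous_measurable_rV; exact: diff_cont.
have near_eq (u v : R -> R) : (forall h, 0 < h -> u h = v h) ->
    \forall h \near 0^'+, u h = v h.
  by move=> uv; near=> h; apply: uv.
(* Here the variance is 0 or +oo: the correlation vanishes at all times, and the right-hand side is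
   k / 0 = 0. *)
have [V0|V0] := eqVneq (fine (variance mu psi)) 0.
  rewrite -/psi V0 invr0 mulr0 oppr0; apply: cvg_near_cst; apply: near_eq => h h0.
  by rewrite /autocorr !(correlation0 P mu X law)// ?ltW// subrr mulr0.
have iw2 := integ_wt2 mu psi mpsi V0.
(* Otherwise [psi] would be constant, against the nonzero variance; so the division in the generator
   is a genuine one. *)
have LS0 : ddot Lam (score_covariance mu p) != 0.
  apply: contra V0 => /eqP LS.
  have cst_psi := ddot_score_eq0_cst mu p psi L hp pE erefl dpsi L0 lpsi iw2 Lam hLam LS.
  have -> : psi = cst (psi 0) by apply/funext => x; exact: cst_psi.
  by rewrite /variance covariance_cst_l.
have [K K0 est] := log_density_increment mu p psi L hp pE erefl dpsi L0 lpsi iw2 Lam P X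
  hLam LS0 hX law.
set V := fine _ in V0 *.
have V_gt0 : 0 < V.
  by rewrite lt_neqAle eq_sym V0 /V fine_varianceE; apply: Rintegral_ge0 => x _; exact: sqr_ge0.
have inc0 : increment2 P X psi 0 = 0.
  rewrite /increment2 -[RHS](@Rintegral0 _ _ _ P); apply: eq_Rintegral => z _.
  by rewrite subrr expr0n.
have bound h : 0 < h -> `|h^-1 * (autocorr h - autocorr 0) - - (k%:R / V)| <= (K / (2 * V)) * Num.sqrt h.
  move=> h0; rewrite /autocorr !(correlation_increment P mu X law psi mpsi) ?(ltW h0)//.
  rewrite inc0 -/V.
  have -> : h^-1 * (1 - increment2 P X psi h / (2 * V) - (1 - 0 / (2 * V))) - - (k%:R / V) =
     - ((increment2 P X psi h - 2 * h * k%:R) / (h * (2 * V))).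
    by field; rewrite !gt_eqF.
  have hV : 0 < h * (2 * V) by rewrite !mulr_gt0.
  rewrite normrN normrM normfV (gtr0_norm hV) ler_pdivrMr//.
  apply: (le_trans (est h h0)); rewrite le_eqVlt; apply/orP; left; apply/eqP.
  by field; rewrite gt_eqF.
have cs : (K / (2 * V)) * Num.sqrt h @[h --> 0^'+] --> (0 : R).
  rewrite -[X in _ --> X](mulr0 (K / (2 * V))); apply: cvgM; first exact: cvg_cst.
  rewrite -[X in _ --> X](@sqrtr0 R); apply: cvg_at_right_filter; exact: sqrt_continuous.
set l := - (k%:R / V) in bound *.
apply: (@squeeze_cvgr _ _ _ _ (fun h => l - (K / (2 * V)) * Num.sqrt h)
  (fun h => l + (K / (2 * V)) * Num.sqrt h)).
- by near=> h; rewrite -ler_distl; apply: bound.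
- rewrite -[X in _ --> X](subr0 l); apply: cvgB => //; exact: cvg_cst.
- rewrite -[X in _ --> X](addr0 l); apply: cvgD => //; exact: cvg_cst.
Unshelve. all: by end_near.
Qed.
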